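(* Let $f,g\colon\mathcal H\to(-\infty,+\infty]$ and the nonempty closed convex set $S\subseteq\mathcal H$ satisfy Assumptions 1, 2 and 3 stated in the context, and let $(x_n)_{n\in\mathbb N}$ be a sequence generated by the e-PSG algorithm described in the context. Suppose that the set $\{x\in S:\frac{f(x)}{g(x)}\le\frac{f(x_0)}{g(x_0)}\}$ is bounded, that $\liminf_{n\to+\infty}\tau_n=\overline\tau>0$, and that $g$ is strictly differentiable on an open set containing $S\cap\operatorname{dom}f$. Then every cluster point $\overline x$ of $(x_n)_{n\in\mathbb N}$ is a stationary point of the problem $\min_{x\in S}\frac{f(x)}{g(x)}$, that is, $\overline x\in S$ and $0\in\partial_L\left(\frac fg+\iota_S\right)(\overline x)$.
   Context: $\mathcal H$ is a finite-dimensional real Hilbert space with inner product $\langle\cdot,\cdot\rangle$ and norm $\|\cdot\|$; $\mathbb N=\{0,1,2,\dots\}$; $\mathbb R_{++}=\{t\in\mathbb R:t>0\}$. For $h\colon\mathcal H\to[-\infty,+\infty]$, $\operatorname{dom}h=\{x:h(x)<+\infty\}$. $\iota_D$ is the indicator function of a set $D$ ($0$ on $D$, $+\infty$ off $D$). The function $\frac fg+\iota_S$ takes the value $+\infty$ outside $S\cap\operatorname{dom}f$. Subdifferentials: for $h$ finite at $x$, the Fréchet subdifferential is $\widehat\partial h(x)=\{u:\liminf_{z\to x}\frac{h(z)-h(x)-\langle u,z-x\rangle}{\|z-x\|}\ge0\}$, and the limiting subdifferential $\partial_L h(x)$ is the set of all $u$ for which there exist $x_n\to x$ with $h(x_n)\to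 h(x)$ and $u_n\in\widehat\partial h(x_n)$ with $u_n\to u$; both are $\varnothing$ where $h$ is not finite. $h$ is regular at $x$ (where $h$ is finite) if $\widehat\partial h(x)=\partial_Lh(x)$; a set $D$ is regular at $x\in D$ if $\iota_D$ is regular at $x$; regular on a set means regular at each of its points. $h$ is strictly differentiable at $x$ if there is $u\in\mathcal H$ with $\lim_{y,z\to x}\frac{h(y)-h(z)-\langle u,y-z\rangle}{\|y-z\|}=0$. $h$ is weakly convex with modulus $\rho\ge0$ if $\rho$ is the smallest nonnegative constant such that $h+\frac\rho2\|\cdot\|^2$ is convex; $h$ is weakly convex on a set $D$ with modulus $\rho$ if $h+\iota_D$ is weakly convex with modulus $\rho$. Assumption 1: $f=f^{\mathfrak s}+f^{\mathfrak n}$, where $f^{\mathfrak s}\colon\mathcal H\to\mathbb R$ is a continuously differentiable convex function whose gradient is Lipschitz continuous with modulus $\ell$ on $\mathcal H$, $f^{\mathfrak n}\colon\mathcal H\to(-\infty,+\infty]$ is proper lower semicontinuous, $S\cap\operatorname{dom}f\ne\varnothing$, and $f(x)\ge0$ for all $x\in S\cap\operatorname{dom}f$. Assumption 2: $g\colon\mathcal H\to(-\infty,+\infty]$ is proper lower semicontinuous, finite and positive on $S$, continuous on an open set containing $S$, and either weakly convex with modulus $\beta$ on an open convex set containing $S$, or regular and weakly convex with modulus $\beta$ on $S$. Assumption 3: $f^{\mathfrak n}=f^{\mathfrak l}+\iota_C$, where $C$ is a nonempty closed subset of $\mathcal H$ such that $C\cap S\ne\varnothing$ and one of the following is satisfied: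 (a) $f^{\mathfrak l}$ is locally Lipschitz continuous on $\mathcal H$ and $C=S=\mathcal H$; (b) $f^{\mathfrak l}$ is locally Lipschitz continuous on an open set containing $S\cap\operatorname{dom}f$, both $f^{\mathfrak l}$ and $C\cap S$ are regular on $S\cap\operatorname{dom}f$, and $g$ is positive on an open set containing $S\cap\operatorname{dom}f$; (c) $f^{\mathfrak l}$ is strictly differentiable on an open set containing $S\cap\operatorname{dom}f$ and $g$ is positive on an open set containing $S\cap\operatorname{dom}f$. Boundedness condition (BC): there exist $m,M\in\mathbb R_{++}$ such that $m\le g(x)\le M$ for all $x\in S\cap\operatorname{dom}f$. e-PSG algorithm. Step 1: choose $x_{-1}=x_0\in S\cap\operatorname{dom}f$. Let $\delta\in\mathbb R_{++}$, let $\zeta\in\mathbb R_{++}$ satisfy $1-\sqrt\beta\zeta>0$, and let $$\overline\mu\in\left[0,\frac{\delta(1-\sqrt\beta\zeta)\sqrt{mM}}{2M}\right),\qquad \overline\kappa\in\left[0,\sqrt{\frac{m\delta(1-\sqrt\beta\zeta)}{\ell M}-\frac{2m\overline\mu}{\ell\sqrt{mM}}}\right),$$ with $m,M$ from (BC) (if $\ell=0$, the upper bound for $\overline\kappa$ is read as $+\infty$). In the absence of (BC), $\overline\mu=0$ and $\overline\kappa=0$. Step 2, for $n=0,1,2,\dots$: set $\theta_n=\frac{f(x_n)}{g(x_n)}$, let $g_n\in\partial_Lg(x_n)$, choose $\tau_n\in\mathbb R$ with $0<\tau_n\le 1/\max\{\sqrt\beta\theta_n/\zeta,\delta\}$; let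 $u_n=x_n+\kappa_n(x_n-x_{n-1})$ with $\kappa_n\in[0,\overline\kappa]$, $v_n=x_n+\mu_n(x_n-x_{n-1})$ with $\mu_n\in[0,\overline\mu\tau_n]$, and find $$x_{n+1}\in\operatorname*{argmin}_{x\in S}\left(f^{\mathfrak n}(x)+f^{\mathfrak s}(u_n)+\langle\nabla f^{\mathfrak s}(u_n),x-u_n\rangle+\frac1{2\tau_n}\|x-v_n-\tau_n\theta_ng_n\|^2+\frac\ell2\|x-u_n\|^2\right).$$ The sequence is assumed to be infinite (the algorithm is run without termination). *)

(* Defs.v *)
From HB Require Import structures.
From mathcomp Require Import all_boot all_order all_algebra.
From mathcomp Require Import sesquilinear.
From mathcomp Require Import boolp classical_sets functions reals ereal.
From mathcomp Require Import topology normedtype sequences convex derive.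

Set Implicit Arguments.
Unset Strict Implicit.
Unset Printing Implicit Defensive.

Import Order.TTheory GRing.Theory Num.Theory.
Import numFieldNormedType.Exports.

Local Open Scope classical_set_scope.
Local Open Scope ring_scope.

Section Definitions.
Context {R : realType} {H : normedModType R}.
(* The inner product; the symmetric bilinear positive definite forms on H are
   the forms of type {dot H for idfun}. *)
Variable ip : {dot H for idfun}.

Implicit Types (h f g fn fl : H -> \bar R) (D S C U : set H).

(* The norm of H is the one of the inner product, and H is spanned by a finite
   family (hence complete). *)
Definition fin_dim_hilbert : Prop :=
  (forall x : H, `|x| = Num.sqrt (ip x x)) /\
  exists (n : nat) (b : 'I_n -> H),
    forall x, exists c : 'I_n -> R, x = \sum_(i < n) c i *: b i.

Definition edom h : set H := [set x | (h x < +oo)%E].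

Definition eproper h : Prop := (forall x, h x != -oo%E) /\ edom h !=set0.

Definition indicator D (x : H) : \bar R := if x \in D then 0%E else +oo%E.

Definition frechet_subdiff h (x : H) : set H :=
  [set u | h x \is a fin_num /\
    (0 <= limf_einf
       (fun z => (h z - h x - (ip u (z - x)%R)%:E) / `|(z - x)%R|%:E) x^')%E].

Definition limiting_subdiff h (x : H) : set H :=
  [set u | h x \is a fin_num /\
    exists xs us : nat -> H,
      [/\ xs n @[n --> \oo] --> x,
          h (xs n) @[n --> \oo] --> h x,
          forall n, frechet_subdiff h (xs n) (us n) &
          us n @[n --> \oo] --> u]].

Definition regular_at h (x : H) : Prop :=
  h x \is a fin_num /\ frechet_subdiff h x = limiting_subdiff h x.

Definition regular_on h D : Prop := forall x, D x -> regular_at h x.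

Definition set_regular_on C D : Prop :=
  forall x, D x -> C x /\ regular_at (indicator C) x.

(* The quotient is taken in \bar R, so its convergence to 0 forces h to be
   finite near x. *)
Definition strictly_differentiable h (x : H) : Prop :=
  h x \is a fin_num /\
  exists u : H,
    ((h p.1 - h p.2 - (ip u (p.1 - p.2)%R)%:E) / `|(p.1 - p.2)%R|%:E)%E
      @[p --> within [set p : H * H | p.1 <> p.2] (nbhs (x, x))] --> 0%E.

Definition strictly_differentiable_near h D : Prop :=
  exists U, [/\ open U, D `<=` U & forall x, U x -> strictly_differentiable h x].

Definition locally_lipschitz_on h U : Prop :=
  forall x, U x -> exists V : set H,
    [/\ nbhs x V, forall y, V y -> h y \is a fin_num &
        exists k : R, k.-lipschitz_V (fine \o h)].

Definition positive_near h D : Prop :=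
  exists U, [/\ open U, D `<=` U & forall x, U x -> (0 < h x)%E].

(* Only used for functions that do not take the value -oo. *)
Definition econvex h : Prop :=
  forall (x y : H) (t : R), 0 < t < 1 ->
    (h (t *: x + (1 - t) *: y)%R <= t%:E * h x + (1 - t)%:E * h y)%E.

Definition weakly_convex h (rho : R) : Prop :=
  let shifted r x := (h x + (r / 2 * `|x| ^+ 2)%:E)%E in
  [/\ 0 <= rho, econvex (shifted rho) &
      forall r, 0 <= r -> econvex (shifted r) -> rho <= r].

Definition weakly_convex_on h D (rho : R) : Prop :=
  weakly_convex (fun x => h x + indicator D x)%E rho.

(* The Riesz representative of the differential of [phi] at [x]. *)
Definition gradient (phi : H -> R^o) (x : H) : H :=
  xget 0 [set u | forall v, 'd phi x v = ip u v].

Definition numer (fs : H -> R^o) fn : H -> \bar R := fun x => ((fs x)%:E + fn x)%E.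

(* Only meaningful on S, where g is finite and positive. *)
Definition quot f g : H -> \bar R := fun x => (f x / g x)%E.

(* f / g + iota_S *)
Definition fractional_objective f g S : H -> \bar R :=
  fun x => if x \in S `&` edom f then quot f g x else +oo%E.

Definition stationary f g S (x : H) : Prop :=
  S x /\ limiting_subdiff (fractional_objective f g S) x 0.

Definition argmin_on S (Phi : H -> \bar R) : set H :=
  [set x | S x /\ forall y, S y -> (Phi x <= Phi y)%E].

Record numerator_assumption S (fs : H -> R^o) fn (ell : R) : Prop := {
  fs_differentiable : forall x, differentiable fs x;
  fs_gradient_continuous : continuous (gradient fs);
  fs_convex : convex_function setT fs;
  ell_ge0 : 0 <= ell;
  fs_gradient_lipschitz : ell.-lipschitz (gradient fs);
  fn_proper : eproper fn;
  fn_lsc : lower_semicontinuous fn;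
  numer_feasible : S `&` edom (numer fs fn) !=set0;
  numer_ge0 : forall x, (S `&` edom (numer fs fn)) x -> (0 <= numer fs fn x)%E
}.

Record denominator_assumption S g (beta : R) : Prop := {
  g_proper : eproper g;
  g_lsc : lower_semicontinuous g;
  g_finite_pos : forall x, S x -> (0 < g x < +oo)%E;
  g_continuous : exists U,
    [/\ open U, S `<=` U & forall x, U x -> {for x, continuous g}];
  g_weakly_convex :
    (exists U, [/\ open U, convex_set U, S `<=` U & weakly_convex_on g U beta])
    \/ (regular_on g S /\ weakly_convex_on g S beta)
}.

Record nonsmooth_assumption S f fn g fl C : Prop := {
  fn_decomposition : forall x, fn x = (fl x + indicator C x)%E;
  fl_gtNy : forall x, fl x != -oo%E;
  C_nonempty : C !=set0;
  C_closed : closed C;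
  C_feasible : C `&` S !=set0;
  fl_cases :
    [\/ [/\ locally_lipschitz_on fl setT, C = setT & S = setT],
        [/\ exists U,
              [/\ open U, S `&` edom f `<=` U & locally_lipschitz_on fl U],
            regular_on fl (S `&` edom f),
            set_regular_on (C `&` S) (S `&` edom f) &
            positive_near g (S `&` edom f)] |
        strictly_differentiable_near fl (S `&` edom f) /\
        positive_near g (S `&` edom f)]
}.

Definition denominator_bounds g D (m M : R) : Prop :=
  [/\ 0 < m, 0 < M & forall x, D x -> (m%:E <= g x <= M%:E)%E].

(* The bounds on the extrapolation parameters; the bound on [kbar] is void when
   [ell = 0], and there is no extrapolation if g has no bounds on [D]. *)
Definition extrapolation_bounds g D (beta ell delta zeta mubar kbar : R) : Prop :=
  (exists m M : R,
     [/\ denominator_bounds g D m M,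
         0 <= mubar < delta * (1 - Num.sqrt beta * zeta) * Num.sqrt (m * M)
                      / (2 * M),
         0 <= kbar &
         ell != 0 ->
         kbar < Num.sqrt (m * delta * (1 - Num.sqrt beta * zeta) / (ell * M)
                          - 2 * m * mubar / (ell * Num.sqrt (m * M)))])
  \/ [/\ ~ (exists m M : R, denominator_bounds g D m M), mubar = 0 & kbar = 0].

(* The sequence is indexed from 0; the convention x_{-1} = x_0 is obtained from
   [x n.-1], as [0.-1 = 0]. *)
Record ePSG S (fs : H -> R^o) fn g (beta ell delta zeta mubar kbar : R)
    (tau kappa mu : nat -> R) (gs u v x : nat -> H) : Prop := {
  init_feasible : (S `&` edom (numer fs fn)) (x 0%N);
  delta_gt0 : 0 < delta;
  zeta_gt0 : 0 < zeta;
  zeta_small : 0 < 1 - Num.sqrt beta * zeta;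
  extrapolation : extrapolation_bounds g (S `&` edom (numer fs fn))
                    beta ell delta zeta mubar kbar;
  ePSG_step : forall n : nat,
    let theta := fine (quot (numer fs fn) g (x n)) in
    [/\ limiting_subdiff g (x n) (gs n),
        0 < tau n <= 1 / Num.max (Num.sqrt beta * theta / zeta) delta,
        u n = x n + kappa n *: (x n - x n.-1) /\ 0 <= kappa n <= kbar,
        v n = x n + mu n *: (x n - x n.-1) /\ 0 <= mu n <= mubar * tau n &
        argmin_on S (fun y =>
          fn y + (fs (u n) + ip (gradient fs (u n)) (y - u n)
                  + 1 / (2 * tau n)
                    * `|y - v n - (tau n * theta) *: gs n| ^+ 2
                  + ell / 2 * `|y - u n| ^+ 2)%:E)%E (x n.+1)]
}.

End Definitions.

(* Main.v *)
(** The argmin property at step n says that f has a proximal subgradient p_n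
at x_(n+1) on the feasible set D.  As g is differentiable at x_(n+1), the
quotient rule for Frechet subgradients gives
  xi_n = (p_n - theta_(n+1) g_(n+1)) / g(x_(n+1))
as a Frechet subgradient of the objective at x_(n+1), where p_n is
theta_n g_n up to terms controlled by the two last displacements.  Near a
point where g is strictly differentiable all its limiting subgradients are
close to the strict gradient; hence g_n is the gradient of g at x_n (which
turns weak convexity on S into a subgradient inequality) and g_n tends to the
gradient at xbar along a subsequence converging to xbar.  The displacements
tend to 0 along such a subsequence by the decrease of a Lyapunov function of
the form theta_n + b |x_n - x_(n-1)|^2.  So xi_n tends to 0, and continuity
of f along D gives the convergence of the values. *)
Require Import Defs.
From HB Require Import structures.
From mathcomp Require Import all_boot all_order all_algebra.
From mathcomp Require Import sesquilinear.
From mathcomp Require Import boolp classical_sets functions reals ereal.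
From mathcomp Require Import topology normedtype sequences convex derive.
From mathcomp Require Import interval_inference ring lra.

Set Implicit Arguments.
Unset Strict Implicit.
Unset Printing Implicit Defensive.

Import Order.TTheory GRing.Theory Num.Theory.
Import numFieldNormedType.Exports.
Local Open Scope classical_set_scope.
Local Open Scope ring_scope.


(** * Inner product: Riesz representation and the Cauchy-Schwarz inequality *)

Section InnerProduct.
Context {R : realType} {H : normedModType R} (ip : {dot H for idfun}).

Lemma ipC (a b : H) : ip a b = ip b a.
Proof. by rewrite (@hermC _ false idfun _ ip) expr0 mul1r. Qed.

Lemma ipDl (a b c : H) : ip (a + b) c = ip a c + ip b c.
Proof. by rewrite ipC raddfD /= !(ipC c). Qed.

Lemma ipDr (a b c : H) : ip a (b + c) = ip a b + ip a c.
Proof. exact: raddfD. Qed.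

Lemma ipNr (a b : H) : ip a (- b) = - ip a b.
Proof. exact: raddfN. Qed.

Lemma ipBr (a b c : H) : ip a (b - c) = ip a b - ip a c.
Proof. exact: raddfB. Qed.

Lemma ipNl (a b : H) : ip (- a) b = - ip a b.
Proof. by rewrite !(ipC _ b) ipNr. Qed.

Lemma ipBl (a b c : H) : ip (a - b) c = ip a c - ip b c.
Proof. by rewrite ipDl ipNl. Qed.

Lemma ipZr (k : R) (a b : H) : ip a (k *: b) = k * ip a b.
Proof. exact: linearZ. Qed.

Lemma ipZl (k : R) (a b : H) : ip (k *: a) b = k * ip a b.
Proof. by rewrite !(ipC _ b) ipZr. Qed.

Lemma ip0l (a : H) : ip 0 a = 0.
Proof. by rewrite ipC raddf0. Qed.

Lemma ip_ge0 (a : H) : 0 <= ip a a.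
Proof.
have [->|a0] := eqVneq a 0; first by rewrite ip0l.
exact/ltW/neq0_dnorm_gt0.
Qed.

Lemma norm_sqr_ip (hH : fin_dim_hilbert ip) (a : H) : `|a| ^+ 2 = ip a a.
Proof. by rewrite (proj1 hH) sqr_sqrtr ?ip_ge0. Qed.

(** Peeling off one generator at a time turns induction on the list into a Gram-Schmidt process. *)
Fixpoint in_span (s : seq H) (z : H) : Prop :=
  if s is b :: s' then exists k, in_span s' (z - k *: b) else z = 0.

Lemma in_spanD s k z w : in_span s z -> in_span s w -> in_span s (z + k *: w).
Proof.
elim: s z w => [|b s IH] z w /=; first by move=> -> ->; rewrite scaler0 addr0.
move=> [l zl] [m wm]; exists (l + k * m).
have -> : z + k *: w - (l + k * m) *: b = (z - l *: b) + k *: (w - m *: b).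
  by rewrite scalerBr scalerA scalerDl opprD addrACA.
exact: IH.
Qed.

Lemma in_span_sum n (b : 'I_n -> H) (c : 'I_n -> R) :
  in_span [seq b i | i <- enum 'I_n] (\sum_(i < n) c i *: b i).
Proof.
rewrite -big_enum /=; elim: (enum 'I_n) => [|i s IH] /=.
  by rewrite big_nil.
by exists (c i); rewrite big_cons addrAC subrr add0r.
Qed.

(** Induction on the generators: [p] represents [ip b] on the span of [s], so it is the orthogonal
    projection of [b], and [e = b - p] is orthogonal to that span. Adding a multiple of [e] to [w]
    corrects the value at [b] and keeps those on the span of [s]. *)
Lemma span_representation (s : seq H) (L : {linear H -> R^o}) :
  exists2 w, in_span s w & forall z, in_span s z -> L z = ip w z.
Proof.
elim: s L => [|b s IH] L /=.
  by exists 0 => // z ->; rewrite ip0l linear0.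
have [p ps pE] := IH (ip b).
have [w ws wE] := IH L.
pose e := b - p; pose k := (L b - ip w b) / ip e e.
have eb : ip e b = ip e e.
  by rewrite [RHS]ipBr (ipBl b p p) pE// subrr subr0.
(* If [e = 0], then [b] already lies in the span of [s] and both sides vanish. *)
have kE : k * ip e b = L b - ip w b.
  have [e0|e0] := eqVneq e 0; last first.
    by rewrite eb divfK// gt_eqF// neq0_dnorm_gt0.
  have bp : b = p by apply/eqP; rewrite -subr_eq0; apply/eqP.
  by rewrite e0 ip0l mulr0 wE ?subrr// bp.
exists (w + k *: e).
  exists k; rewrite /e scalerBr addrA addrAC addrK -scaleNr.
  exact: in_spanD.
move=> z [a]; move: (z - a *: b) (subrK (a *: b) z) => y <- ys.
rewrite linearD linearZ /= ipDr ipZr !ipDl !ipZl kE (addrC (ip w b)) subrK.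
by rewrite wE// (ipBl b p) pE// subrr mulr0 addr0.
Qed.

Lemma riesz_representation (hH : fin_dim_hilbert ip) (L : {linear H -> R^o}) :
  exists w, forall z, L z = ip w z.
Proof.
have [n [b bE]] := proj2 hH.
have [w _ wE] := span_representation [seq b i | i <- enum 'I_n] L.
by exists w => z; apply: wE; have [c ->] := bE z; exact: in_span_sum.
Qed.

(** By Riesz representation the set in [gradient] is nonempty, so [xget] does not fall back on its
    default value. *)
Lemma gradientE (hH : fin_dim_hilbert ip) (phi : H -> R^o) (x v : H) :
  'd phi x v = ip (gradient ip phi x) v.
Proof.
rewrite /gradient; case: xgetP => [w _ /= ->//|] /=.
by have [w wE] := riesz_representation hH ('d phi x); move=> /(_ w)/(_ wE).
Qed.

Lemma normD_sqr (hH : fin_dim_hilbert ip) (a b : H) :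
  `|a + b| ^+ 2 = `|a| ^+ 2 + 2 * ip a b + `|b| ^+ 2.
Proof. by rewrite !norm_sqr_ip// ipDl !ipDr (ipC b a); ring. Qed.

Lemma cauchy_schwarz (hH : fin_dim_hilbert ip) (a b : H) :
  ip a b <= `|a| * `|b|.
Proof.
have [->|b0] := eqVneq b 0; first by rewrite ipC ip0l normr0 mulr0.
have nb0 : 0 < `|b| by rewrite normr_gt0.
(* The squared norm of this vector is [2 |a| |b| (|a| |b| - ip a b)]. *)
have := ip_ge0 (`|b| *: a - `|a| *: b).
rewrite ipBl !ipBr !ipZl !ipZr (ipC b a) -!norm_sqr_ip// => h.
have {}h : 0 <= 2 * (`|a| * `|b|) * (`|a| * `|b| - ip a b) by nra.
have [a0|a0] := eqVneq a 0; first by rewrite a0 ip0l normr0 mul0r.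
have na0 : 0 < `|a| by rewrite normr_gt0.
by move: h; rewrite pmulr_rge0 ?subr_ge0// !mulr_gt0.
Qed.

Lemma cauchy_schwarz_norm (hH : fin_dim_hilbert ip) (a b : H) :
  `|ip a b| <= `|a| * `|b|.
Proof.
rewrite ler_norml cauchy_schwarz// andbT lerNl -ipNl.
by rewrite (le_trans (cauchy_schwarz hH _ _))// normrN.
Qed.

End InnerProduct.

(** * Smooth convex functions: gradient inequality and descent lemma *)

Section SmoothConvex.
Context {R : realType} {H : normedModType R} (ip : {dot H for idfun}).
Context (hH : fin_dim_hilbert ip).

Lemma convex_functionE (phi : H -> R^o) (x y : H) (t : R) :
  convex_function setT phi -> 0 < t < 1 ->
  phi (t *: x + (1 - t) *: y) <= t * phi x + (1 - t) * phi y.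
Proof.
move=> cphi /andP[t0 t1].
by have := cphi (Itv01 (ltW t0) (ltW t1)) x y; rewrite !inE => /(_ I I).
Qed.

(** By convexity the difference quotients from [x] towards [y] are at most [phi y - phi x]; their
    limit from the right is the directional derivative. *)
Lemma convex_gradient_le (phi : H -> R^o) (x y : H) :
  convex_function setT phi -> differentiable phi x ->
  phi x + ip (gradient ip phi x) (y - x) <= phi y.
Proof.
move=> cphi dphi; rewrite -lerBrDl -gradientE// -deriveE//.
have dq : h^-1 *: ((phi \o shift x) (h *: (y - x)) - phi x)
    @[h --> (0 : R)^'+] --> 'D_(y - x) phi x.
  exact/cvg_dnbhs_at_right/diff_derivable.
apply: (cvgr_to_le dq); near=> h.
have h01 : 0 < h < 1.
  apply/andP; split; near: h; first exact: nbhs_right_gt.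
  exact: nbhs_right_lt.
have h0 : 0 < h by case/andP: h01.
rewrite /= -[_ *: _]/(_ * _) mulrC ler_pdivrMr// lerBlDr.
have := convex_functionE y x cphi h01.
have -> : h *: y + (1 - h) *: x = h *: (y - x) + x.
  by rewrite scalerBr scalerBl scale1r addrA addrAC.
by move=> /le_trans; apply; rewrite le_eqVlt; apply/orP; left; apply/eqP; ring.
Unshelve. all: by end_near. Qed.

(* Sums the gradient inequality over a fine subdivision of the segment. *)
Lemma descent_lemma (phi : H -> R) (G : H -> H) (ell : R) :
  (forall x y, phi x + ip (G x) (y - x) <= phi y) ->
  (forall x y, `|G x - G y| <= ell * `|x - y|) ->
  forall x y, phi y <= phi x + ip (G x) (y - x) + ell / 2 * `|y - x| ^+ 2.
Proof.
move=> Gle Glip x y; set d := y - x.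
(* The gradient inequality at the new point [q] towards the previous point [p] bounds each
   increment, and the Lipschitz bound compares [G q] with [G x]; the errors add up like
   [1 + ... + k]. *)
have step (h : R) (k : nat) : 0 <= h ->
    phi (x + (k%:R * h) *: d) <= phi x + k%:R * h * ip (G x) d
      + ell * `|d| ^+ 2 * h ^+ 2 * (k%:R * (k%:R + 1) / 2).
  move=> h0; elim: k => [|k IH].
    by rewrite mul0r scale0r addr0 !mul0r mulr0 !addr0.
  set p := x + (k%:R * h) *: d in IH *; set q := x + _ *: d.
  have qp : p - q = - (h *: d).
    rewrite /p /q opprD addrACA subrr add0r -scalerBl -natr1 -[RHS]scaleNr.
    by congr (_ *: d); ring.
  have qx : q - x = ((k%:R + 1) * h) *: d.
    by rewrite /q addrAC subrr add0r -natr1.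
  have := Gle q p; rewrite qp ipNr ipZr => Gq.
  have : ip (G q - G x) d <= ell * ((k%:R + 1) * h * `|d|) * `|d|.
    rewrite (le_trans (cauchy_schwarz hH _ _))// ler_wpM2r//.
    rewrite (le_trans (Glip _ _))// qx normrZ.
    by rewrite ger0_norm ?mulr_ge0 ?addr_ge0.
  rewrite ipBl => /(ler_wpM2l h0) cs.
  rewrite -natr1.
  have -> : phi x + (k%:R + 1) * h * ip (G x) d + ell * `|d| ^+ 2 * h ^+ 2 *
      ((k%:R + 1) * (k%:R + 1 + 1) / 2) = phi x + k%:R * h * ip (G x) d
      + ell * `|d| ^+ 2 * h ^+ 2 * (k%:R * (k%:R + 1) / 2) + h * ip (G x) d +
      h * (ell * ((k%:R + 1) * h * `|d|) * `|d|) by field.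
  lra.
apply/ler_addgt0Pr => e e0.
(* With [N.+1] pieces the excess over the claim is [ell |d|^2 / (2 N.+1)]; [N] is chosen to make it
   at most [e], whatever the sign of [ell]. *)
pose c := `|ell| * `|d| ^+ 2 / 2.
have c0 : 0 <= c by rewrite /c !mulr_ge0.
have := truncnS_gt (c / e); set N := Num.truncn _.
have n0 : 0 < N.+1%:R :> R by rewrite ltr0n.
rewrite ltr_pdivrMr// => /ltW cN.
have := step N.+1%:R^-1 N.+1; rewrite invr_ge0 ltW// => /(_ isT).
have nE : N.+1%:R * N.+1%:R^-1 = 1 :> R by rewrite divff// gt_eqF.
rewrite nE scale1r {1}/d (addrC x) subrK mul1r => /le_trans; apply.
rewrite -!addrA !lerD2l.
have -> : ell * `|d| ^+ 2 * N.+1%:R^-1 ^+ 2 * (N.+1%:R * (N.+1%:R + 1) / 2) =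
  ell / 2 * `|d| ^+ 2 + ell * `|d| ^+ 2 / 2 / N.+1%:R.
  by field; rewrite nat1r gt_eqF.
rewrite lerD2l ler_pdivrMr// [leRHS]mulrC (le_trans _ cN)//.
by rewrite /c !ler_wpM2r ?ler_norm.
Qed.

End SmoothConvex.

(** * Frechet and limiting subgradients near a point of strict differentiability *)

Section Subdifferentials.
Context {R : realType} {H : normedModType R} (ip : {dot H for idfun}).
Context (hH : fin_dim_hilbert ip).

Lemma nbhs_distP (x : H) (A : set H) :
  nbhs x A <-> exists2 r : R, 0 < r & forall z, `|z - x| < r -> A z.
Proof.
split=> [/nbhs_normP[r /= r0 rA]|[r r0 rA]].
  by exists r => // z zx; apply: rA; rewrite /= distrC.
by apply/nbhs_normP; exists r => //= z zx; apply: rA; rewrite distrC.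
Qed.

(** The lower limit in epsilon form, with the denominator cleared so that [z = x] is included. *)
Lemma frechet_subdiff_ge (h : H -> \bar R) (x u : H) (e : R) :
  frechet_subdiff ip h x u -> 0 < e ->
  exists2 r : R, 0 < r &
    forall z, `|z - x| < r ->
      (h x + (ip u (z - x)%R - e * `|(z - x)%R|)%:E <= h z)%E.
Proof.
move=> [hx]; rewrite limf_einfE => h0 e0.
have /ereal_sup_gt[_ [V /nbhs_distP[r r0 rV] <-] eV] : ((- e)%:E <
    ereal_sup [set ereal_inf ((fun z => (h z - h x - (ip u (z - x)%R)%:E)
      / `|(z - x)%R|%:E) @` V) | V in x^'])%E.
  by apply: lt_le_trans h0; rewrite lte_fin oppr_lt0.
exists r => // z zr; have [->|zx] := eqVneq z x.
  by rewrite subrr normr0 mulr0 ipC ip0l subr0 adde0.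
have d0 : 0 < `|z - x| by rewrite normr_gt0 subr_eq0.
have /(lt_le_trans eV) : (ereal_inf ((fun z => (h z - h x - (ip u (z - x)%R)%:E)
      / `|(z - x)%R|%:E) @` V) <= (h z - h x - (ip u (z - x)%R)%:E)
      / `|(z - x)%R|%:E)%E.
  by apply: ereal_inf_lbound; exists z => //; apply: rV.
rewrite inver gt_eqF//; case: (h x) hx => // a _.
case: (h z) => [b|_|]; last 2 first.
- by rewrite leey.
- by rewrite /= gt0_mulNye ?lte_fin ?invr_gt0.
rewrite -!EFinB -EFinM lte_fin -EFinD lee_fin ltr_pdivlMr// => ?; lra.
Qed.

Lemma frechet_subdiffI (h : H -> \bar R) (x u : H) :
  h x \is a fin_num ->
  (forall e : R, 0 < e -> exists2 r : R, 0 < r &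
    forall z, `|z - x| < r ->
      (h x + (ip u (z - x)%R - e * `|(z - x)%R|)%:E <= h z)%E) ->
  frechet_subdiff ip h x u.
Proof.
move=> hx hz; split=> //; rewrite limf_einfE; apply/lee_addgt0Pr => e e0.
have [r r0 rV] := hz e e0.
pose V : set H := [set z | `|z - x| < r /\ z != x].
rewrite -leeBlDr// sub0e.
apply: le_trans (ereal_sup_ubound _); last first.
  exists V => //.
  by apply/nbhs_distP; exists r => // z zr zx; split.
apply: le_ereal_inf_tmp => _ [z [zr zx] <-].
have d0 : 0 < `|z - x| by rewrite normr_gt0 subr_eq0.
have := rV z zr; rewrite inver gt_eqF//; case: (h x) hx => // a _.
case: (h z) => [b|_|//]; last first.
  by rewrite gt0_mulye ?lte_fin ?invr_gt0// leey.
rewrite -!EFinB -EFinM -EFinN !lee_fin ler_pdivlMr// => ?; lra.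
Qed.

(** Clearing the denominator admits [y = z]; finiteness near [x], implicit in the extended-real
    quotient, becomes explicit. *)
Definition strict_gradient (h : H -> \bar R) (x u : H) : Prop :=
  h x \is a fin_num /\ forall e : R, 0 < e -> exists2 r : R, 0 < r &
    forall y z, `|y - x| < r -> `|z - x| < r ->
      [/\ h y \is a fin_num, h z \is a fin_num &
          `|fine (h y) - fine (h z) - ip u (y - z)| <= e * `|y - z|].

Lemma strict_gradientP (h : H -> \bar R) (x : H) :
  strictly_differentiable ip h x -> exists u, strict_gradient h x u.
Proof.
move=> [hx [u hu]]; exists u; split=> // e e0.
have /hu : nbhs 0%E [set a : \bar R | (`|a| < e%:E)%E].
  exists e => //= a /=; rewrite sub0r normrN lte_fin => //.
rewrite /= => -[[A B] /= [/nbhs_distP[r1 r10 Ar] /nbhs_distP[r2 r20 Br]] AB].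
exists (Num.min r1 r2) => [|y z]; first by rewrite lt_min r10.
rewrite !lt_min => /andP[y1 y2] /andP[z1 z2].
have key a b : `|a - x| < r1 -> `|b - x| < r2 -> a <> b ->
    [/\ h a \is a fin_num, h b \is a fin_num &
        `|fine (h a) - fine (h b) - ip u (a - b)| <= e * `|a - b|].
  move=> ar br ab; have := AB (a, b) (conj (Ar _ ar) (Br _ br)) ab.
  have d0 : 0 < `|a - b| by rewrite normr_gt0 subr_eq0; apply/eqP.
  have di : (0 < (`|a - b|^-1)%:E :> \bar R)%E by rewrite lte_fin invr_gt0.
  rewrite /= inver gt_eqF//.
  (* If one of the two values is infinite, so is the difference, and the quotient cannot be below
     [e]. *)
  case: (h a) => [a'||]; case: (h b) => [b'||] //=;
    rewrite ?(gt0_mulye di) ?(gt0_mulNye di) //.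
  move=> E; split=> //; move: E.
  rewrite lte_fin normrM normfV normr_id ltr_pdivrMr//.
  exact: ltW.
(* On the diagonal only finiteness is at stake; it comes from the pair [(y, x)], or from [hx] when
   [y = x]. *)
have [yz|yz] := eqVneq y z; last by apply: key => //; apply/eqP.
rewrite -yz !subrr sub0r normrN normr0 mulr0 ipC ip0l normr0.
have [->|yx] := eqVneq y x; first by split.
by have [] := key y x y1 _ (elimN eqP yx); rewrite ?subrr ?normr0.
Qed.

(** Testing the subgradient inequality at [y + t d] with [d = w - u] gives [t (|d|^2 - e |d|) <= 0],
    half of [e] coming from each hypothesis. *)
Lemma frechet_subdiff_strict_gradient (h : H -> \bar R) (x u : H) (e : R) :
  strict_gradient h x u -> 0 < e ->
  exists2 r : R, 0 < r & forall y w, `|y - x| < r ->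
    frechet_subdiff ip h y w -> `|w - u| <= e.
Proof.
move=> [hx hu] e0; have e20 : 0 < e / 2 by rewrite divr_gt0.
have [r r0 rP] := hu _ e20; exists r => // y w yr /frechet_subdiff_ge/(_ e20).
move=> [s s0 sP]; pose d := w - u; rewrite -/d.
have [->|d0] := eqVneq d 0; first by rewrite normr0 ltW.
have nd0 : 0 < `|d| by rewrite normr_gt0.
(* The length [m / 2] keeps the test point within [s] of [y] and within [r] of [x]. *)
pose m := Num.min s (r - `|y - x|); pose t := m / 2 / `|d|.
have m0 : 0 < m by rewrite lt_min s0 subr_gt0.
have t0 : 0 < t by rewrite !divr_gt0.
pose z := y + t *: d.
have zy : z - y = t *: d by rewrite /z addrC addKr.
have nzy : `|z - y| = m / 2 by rewrite zy normrZ gtr0_norm// divfK// gt_eqF.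
have zs : `|z - y| < s.
  have : m <= s by rewrite /m ge_min lexx.
  rewrite nzy; lra.
have zr : `|z - x| < r.
  have : m <= r - `|y - x| by rewrite /m ge_min lexx orbT.
  have := ler_normD (z - y) (y - x); rewrite addrA subrK nzy; lra.
have [hz hy] := rP z y zr yr.
have := sP z zs; rewrite -(fineK hz) -(fineK hy) -EFinD lee_fin.
rewrite zy normrZ gtr0_norm// !ipZr => h1 /ler_normlP[_ h2].
have : t * (ip w d - ip u d - e * `|d|) <= 0 by lra.
rewrite pmulr_rle0// -ipBl -/d -norm_sqr_ip// subr_le0 expr2.
by rewrite ler_pM2r.
Qed.

(** The ball is open, so the points approximating [y] eventually lie in it and the Frechet bound
    passes to the limit. *)
Lemma limiting_subdiff_strict_gradient (h : H -> \bar R) (x u : H) (e : R) :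
  strict_gradient h x u -> 0 < e ->
  exists2 r : R, 0 < r & forall y w, `|y - x| < r ->
    limiting_subdiff ip h y w -> `|w - u| <= e.
Proof.
move=> hu e0; have [r r0 rP] := frechet_subdiff_strict_gradient hu e0.
exists r => // y w yr [_ [ys [ws [yy _ wF ww]]]].
have wu : `|ws n - u| @[n --> \oo] --> `|w - u|.
  by apply: cvg_norm; apply: cvgB => //; exact: cvg_cst.
apply: (cvgr_to_le wu).
have : \forall n \near \oo, `|ys n - y| < r - `|y - x|.
  have r1 : 0 < r - `|y - x| by rewrite subr_gt0.
  by move/cvgrPdistC_lt : yy; apply.
apply: filterS => n nr; apply: rP (wF n).
by have := ler_normD (ys n - y) (y - x); rewrite addrA subrK; lra.
Qed.

Lemma limiting_subdiff_eq_strict_gradient (h : H -> \bar R) (x u w : H) :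
  strict_gradient h x u -> limiting_subdiff ip h x w -> w = u.
Proof.
move=> hu hw; apply/eqP; rewrite -subr_eq0 -normr_le0.
apply/ler_addgt0Pr => e e0.
have [r r0 rP] := limiting_subdiff_strict_gradient hu e0.
by rewrite add0r; apply: rP hw; rewrite subrr normr0.
Qed.

End Subdifferentials.

(** * Weak convexity, and Frechet subgradients of a quotient *)

Section Quotients.
Context {R : realType} {H : normedModType R} (ip : {dot H for idfun}).
Context (hH : fin_dim_hilbert ip).

Lemma convex_set_segment (S : set H) (x y : H) (t : R) :
  convex_set S -> S x -> S y -> 0 < t < 1 -> S (t *: x + (1 - t) *: y).
Proof.
move=> cS Sx Sy /andP[t0 t1].
by have := cS x y (Itv01 (ltW t0) (ltW t1)); rewrite !inE; exact.
Qed.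

Lemma norm_segment_sqr (x y : H) (t : R) :
  `|t *: x + (1 - t) *: y| ^+ 2 =
  t * `|x| ^+ 2 + (1 - t) * `|y| ^+ 2 - t * (1 - t) * `|x - y| ^+ 2.
Proof.
rewrite !(norm_sqr_ip hH) !(ipDl, ipDr, ipBl, ipBr, ipZl, ipZr, ipNl, ipNr).
by rewrite (ipC ip y x); ring.
Qed.

(** The defect is that of [beta / 2 |.|^2] in [norm_segment_sqr]. Allowing a superset [U] of [S]
    treats both alternatives for [g] at once. *)
Lemma weakly_convex_segment (g : H -> \bar R) (S U : set H) (beta t : R)
    (x y : H) :
  weakly_convex_on g U beta -> S `<=` U -> convex_set S ->
  (forall z, S z -> g z \is a fin_num) -> S x -> S y -> 0 < t < 1 ->
  fine (g (t *: x + (1 - t) *: y)) <= t * fine (g x) + (1 - t) * fine (g y)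
    + beta / 2 * (t * (1 - t) * `|x - y| ^+ 2).
Proof.
move=> [_ + _] SU cS gS Sx Sy t01 => /(_ x y t t01).
have Sz := convex_set_segment cS Sx Sy t01.
rewrite /indicator !mem_set; try exact: SU.
rewrite !adde0 -(fineK (gS _ Sx)) -(fineK (gS _ Sy)) -(fineK (gS _ Sz)).
rewrite -!(EFinD, EFinM) lee_fin norm_segment_sqr /=; lra.
Qed.

(** Divide the segment inequality by [t] and let [t] tend to 0; the limit is replaced by one [t]
    small enough for an error [e]. *)
Lemma strict_gradient_weakly_convex_le (g : H -> \bar R) (beta : R)
    (x y w : H) :
  strict_gradient ip g x w -> 0 <= beta ->
  (forall t, 0 < t < 1 ->
    fine (g (t *: y + (1 - t) *: x)) <= t * fine (g y) + (1 - t) * fine (g x)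
      + beta / 2 * (t * (1 - t) * `|y - x| ^+ 2)) ->
  fine (g x) + ip w (y - x) - beta / 2 * `|y - x| ^+ 2 <= fine (g y).
Proof.
move=> [_ gw] beta0 gt; set d := y - x in gt *.
apply/ler_addgt0Pr => e e0.
have d1 : 0 < `|d| + 1 by rewrite ltr_wpDl.
(* Dividing by [|d| + 1] covers [d = 0] and keeps the error [q |d|] below [e]. *)
have [r r0 rP] := gw (e / (`|d| + 1)) (divr_gt0 e0 d1).
pose t := Num.min (1 / 2) (r / (`|d| + 1) / 2).
have t0 : 0 < t by rewrite lt_min !divr_gt0.
have t12 : t <= 1 / 2 by rewrite ge_min lexx.
have t01 : 0 < t < 1 by rewrite t0 /=; lra.
have zx : t *: y + (1 - t) *: x - x = t *: d.
  by rewrite scalerBl scale1r scalerBr (addrC x) addrA addrK.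
have tr : t * `|d| < r.
  have : t <= r / (`|d| + 1) / 2 by rewrite ge_min lexx orbT.
  have := divfK (lt0r_neq0 d1) r; set q := r / _ => qE tq.
  have : 0 < q by rewrite divr_gt0.
  nra.
have [||_ _] := rP (t *: y + (1 - t) *: x) x.
- by rewrite zx normrZ gtr0_norm.
- by rewrite subrr normr0.
rewrite zx normrZ gtr0_norm// ipZr => /ler_normlP[+ _].
have := divfK (lt0r_neq0 d1) e; set q := e / _ => qE.
have q0 : 0 < q by rewrite divr_gt0.
move=> h1; have h2 := gt t t01.
have h3 : t * (1 - t) * (beta / 2 * `|d| ^+ 2) <= t * (beta / 2 * `|d| ^+ 2).
  by rewrite ler_wpM2r ?mulr_ge0 ?divr_ge0//; nra.
have h4 : 0 <= t * (fine (g y) + q * `|d| + beta / 2 * `|d| ^+ 2 - fine (g x)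
   - ip w d) by lra.
rewrite pmulr_rge0// in h4.
nra.
Qed.

Lemma quot_fineE (f g : H -> \bar R) (z : H) :
  f z \is a fin_num -> (0 < g z < +oo)%E ->
  quot f g z = (fine (f z) / fine (g z))%:E.
Proof.
rewrite /quot; case: (g z) => [b||] //; last by rewrite andbF.
case: (f z) => // a _; rewrite lte_fin => /andP[b0 _].
by rewrite inver gt_eqF.
Qed.

Lemma fine_quot_gt0 (g : H -> \bar R) (z : H) :
  (0 < g z < +oo)%E -> 0 < fine (g z).
Proof. by move=> ?; apply: fine_gt0. Qed.

Lemma fractional_objectiveE (f g : H -> \bar R) (S : set H) (z : H) :
  (S `&` edom f) z -> f z \is a fin_num -> (0 < g z < +oo)%E ->
  fractional_objective f g S z = (fine (f z) / fine (g z))%:E.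
Proof. by move=> Dz *; rewrite /fractional_objective mem_set// quot_fineE. Qed.

(** With [th = f x / g x] and [xi] the claimed subgradient, [p = g x xi + th w]. Hence
    [f z - th g z] is at least [g x <xi, z - x>] up to [o(|z - x|)], and replacing [g x] by [g z]
    costs a second-order term. Off [D] the objective is [+oo]. *)
Lemma frechet_subdiff_quot (f g : H -> \bar R) (S : set H) (K : R)
    (x p w : H) :
  let D := S `&` edom f in
  (forall z, D z -> f z \is a fin_num) ->
  (forall z, S z -> (0 < g z < +oo)%E) ->
  D x -> (0 <= f x)%E -> strict_gradient ip g x w -> 0 <= K ->
  (forall z, D z ->
    fine (f x) + ip p (z - x) - K * `|z - x| ^+ 2 <= fine (f z)) ->
  frechet_subdiff ip (fractional_objective f g S) x
    ((fine (g x))^-1 *: (p - (fine (f x) / fine (g x)) *: w)).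
Proof.
move=> D fD gS Dx fx0 [gx gw] K0 fp.
have a0 : 0 < fine (g x) := fine_quot_gt0 (gS _ Dx.1).
have fE z : D z -> fractional_objective f g S z = (fine (f z) / fine (g z))%:E.
  by move=> Dz; rewrite fractional_objectiveE//; [exact: fD|exact: gS Dz.1].
apply: frechet_subdiffI; first by rewrite fE.
move=> e e0.
set a := fine (g x) in a0 *; set th := fine (f x) / a; set xi := _^-1 *: _.
have th0 : 0 <= th := divr_ge0 (fine_ge0 fx0) (ltW a0).
have fxE : fine (f x) = th * a by rewrite divfK// gt_eqF.
have xiE : p = a *: xi + th *: w.
  by rewrite /xi scalerA divff ?gt_eqF// scale1r subrK.
clearbody xi.
(* Once [b >= a / 2], the allowance [b e |d|] is at least [a e |d| / 2]; it is shared equally by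
   [th e1 |d|], [K |d|^2] and [(a - b) ip xi d]. *)
pose e1 := a * e / 6 / (th + 1).
have th1 : 0 < th + 1 by rewrite ltr_wpDl.
have e10 : 0 < e1 by rewrite !divr_gt0 ?mulr_gt0.
have the1 : th * e1 <= a * e / 6.
  have := divfK (lt0r_neq0 th1) (a * e / 6); rewrite -/e1; lra.
have [r1 r10 rP] := gw e1 e10.
(* [L] bounds the growth of [g] from [x]; [M |d| < m] bounds [L |d|], [L |xi| |d|] and [K |d|]
   simultaneously. *)
pose L := `|w| + e1; have L0 : 0 < L by rewrite ltr_wpDl.
pose M := 1 + L + L * `|xi| + K.
have M0 : 0 < M.
  have : 0 <= L * `|xi| by rewrite mulr_ge0 ?(ltW L0).
  by rewrite /M; lra.
pose m := Num.min (a / 2) (a * e / 6).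
have m0 : 0 < m by rewrite lt_min !divr_gt0 ?mulr_gt0.
exists (Num.min r1 (m / M)) => [|z]; first by rewrite lt_min r10 divr_gt0.
rewrite lt_min => /andP[zr1]; rewrite ltr_pdivlMr// => zM.
rewrite /fractional_objective -/(fractional_objective f g S x) fE//.
case: ifPn => [/set_mem Dz|]; last by rewrite leey.
rewrite quot_fineE; [|exact: fD|exact: gS Dz.1].
rewrite -EFinD lee_fin -/a -/th.
have [_ _] : [/\ _, _ & _] := rP z x zr1 ltac:(by rewrite subrr normr0).
set b := fine (g z); set d := z - x in zM *; rewrite -/a => /ler_normlP[g1 g2].
have b0 : 0 < b := fine_quot_gt0 (gS _ Dz.1).
have [w1 w2] : - (`|w| * `|d|) <= ip w d /\ ip w d <= `|w| * `|d|.
  by have := cauchy_schwarz_norm hH w d; rewrite ler_norml => /andP[].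
have [x1 x2] : - (`|xi| * `|d|) <= ip xi d /\ ip xi d <= `|xi| * `|d|.
  by have := cauchy_schwarz_norm hH xi d; rewrite ler_norml => /andP[].
have nd0 : 0 <= `|d| by [].
have [mc me] : m <= a / 2 /\ m <= a * e / 6 by rewrite !ge_min !lexx orbT.
have xi0 : 0 <= L * `|xi| * `|d| by rewrite !mulr_ge0 ?(ltW L0).
have Kd0 : 0 <= K * `|d| by rewrite mulr_ge0.
have Ld0 : 0 <= L * `|d| by rewrite mulr_ge0 ?(ltW L0).
have MdE : `|d| * M = `|d| + L * `|d| + L * `|xi| * `|d| + K * `|d|.
  by rewrite /M; ring.
have Ld : L * `|d| <= a / 2 by lra.
have Lxd : L * `|xi| * `|d| <= a * e / 6 by lra.
have Kd : K * `|d| <= a * e / 6 by lra.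
have LE : L * `|d| = `|w| * `|d| + e1 * `|d| by rewrite /L mulrDl.
have ab : `|a - b| <= L * `|d| by rewrite ler_norml; apply/andP; split; lra.
have b2 : a / 2 <= b by move: ab => /ler_normlP[_]; lra.
have abx : - (a * e / 6 * `|d|) <= (a - b) * ip xi d.
  have : `|(a - b) * ip xi d| <= L * `|xi| * `|d| * `|d|.
    rewrite normrM (_ : L * _ * _ * _ = L * `|d| * (`|xi| * `|d|));
      last by ring.
    by rewrite ler_pM// ler_norml x1.
  rewrite ler_norml => /andP[+ _]; apply: le_trans; rewrite lerN2.
  by rewrite ler_wpM2r.
have Kdd : K * `|d| ^+ 2 <= a * e / 6 * `|d|.
  by rewrite expr2 mulrA ler_wpM2r.
have thd : th * e1 * `|d| <= a * e / 6 * `|d| by rewrite ler_wpM2r.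
have bd : a / 2 * (e * `|d|) <= b * (e * `|d|).
  by rewrite ler_wpM2r// mulr_ge0// ltW.
rewrite ler_pdivlMr//.
have := fp z Dz; rewrite -/d fxE xiE ipDl !ipZl => fz.
apply: le_trans fz.
have thb : th * b <= th * (a + ip w d + e1 * `|d|).
  by rewrite ler_wpM2l//; lra.
lra.
Qed.

(** Calmness at one point is what the strict differentiability and Lipschitz alternatives for [fl]
    have in common; it yields convergence of values. *)
Lemma strict_gradient_calm (h : H -> \bar R) (x u : H) :
  strict_gradient ip h x u ->
  exists k r : R, 0 < r /\ forall y, `|y - x| < r ->
    h y \is a fin_num /\ `|fine (h y) - fine (h x)| <= k * `|y - x|.
Proof.
move=> [hx /(_ 1 ltr01)[r r0 rP]]; exists (`|u| + 1), r; split=> // y yr.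
have [|hy _ h1] := rP y x yr; first by rewrite subrr normr0.
split=> //.
have := cauchy_schwarz_norm hH u (y - x).
have := ler_normD (fine (h y) - fine (h x) - ip u (y - x)) (ip u (y - x)).
rewrite subrK; lra.
Qed.

Lemma locally_lipschitz_calm (h : H -> \bar R) (U : set H) (x : H) :
  locally_lipschitz_on h U -> U x ->
  exists k r : R, 0 < r /\ forall y, `|y - x| < r ->
    h y \is a fin_num /\ `|fine (h y) - fine (h x)| <= k * `|y - x|.
Proof.
move=> hU /hU[V [/nbhs_distP[r r0 rV] hV [k kV]]]; exists k, r; split=> // y yr.
have Vy := rV y yr; split; first exact: hV.
apply: (kV (y, x)); split=> //=; apply: rV; by rewrite subrr normr0.
Qed.

End Quotients.

(** * One proximal step: decrease and proximal subgradient *)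

Section Descent.
Context {R : realType} {H : normedModType R} (ip : {dot H for idfun}).
Context (hH : fin_dim_hilbert ip).

(** By convexity the linearization of [phi] at [u] is at most [phi x1] at [x1]; by the descent lemma
    the linearization plus the penalty [ell / 2 |x2 - u|^2] is at least [phi x2]. *)
Lemma proximal_step_decrease (phi Fn : H -> R) (G : H -> H)
    (ell tau theta kappa mu : R) (x0 x1 x2 u v w : H) :
  (forall x y, phi x + ip (G x) (y - x) <= phi y) ->
  (forall x y, phi y <= phi x + ip (G x) (y - x) + ell / 2 * `|y - x| ^+ 2) ->
  0 < tau -> u = x1 + kappa *: (x1 - x0) -> v = x1 + mu *: (x1 - x0) ->
  Fn x2 + (phi u + ip (G u) (x2 - u)
    + 1 / (2 * tau) * `|x2 - v - (tau * theta) *: w| ^+ 2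
    + ell / 2 * `|x2 - u| ^+ 2) <=
  Fn x1 + (phi u + ip (G u) (x1 - u)
    + 1 / (2 * tau) * `|x1 - v - (tau * theta) *: w| ^+ 2
    + ell / 2 * `|x1 - u| ^+ 2) ->
  phi x2 + Fn x2 <= phi x1 + Fn x1 - 1 / (2 * tau) * `|x2 - x1| ^+ 2
    + mu / tau * ip (x2 - x1) (x1 - x0) + theta * ip w (x2 - x1)
    + ell / 2 * kappa ^+ 2 * `|x1 - x0| ^+ 2.
Proof.
move=> Gle Gge tau0 uE vE.
set d := x1 - x0 in uE vE *; set e := x2 - x1.
clearbody d.
have x2v : x2 - v - (tau * theta) *: w = e - mu *: d - (tau * theta) *: w.
  by rewrite vE opprD addrA.
have x1v : x1 - v - (tau * theta) *: w = - (mu *: d) - (tau * theta) *: w.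
  by rewrite vE opprD addrA subrr add0r.
have x1u : x1 - u = - (kappa *: d) by rewrite uE opprD addrA subrr add0r.
rewrite x2v x1v; clearbody e.
(* Both proximal squares are expressed through the same square [q], which then cancels. *)
have -> : `|e - mu *: d - (tau * theta) *: w| ^+ 2 =
    `|- (mu *: d) - (tau * theta) *: w| ^+ 2 + `|e| ^+ 2
    - 2 * mu * ip e d - 2 * tau * theta * ip w e.
  rewrite !(norm_sqr_ip hH) !(ipDl, ipDr, ipNl, ipNr, ipZl, ipZr).
  by rewrite (ipC ip d e) (ipC ip d w) (ipC ip w e); ring.
have -> : `|x1 - u| ^+ 2 = kappa ^+ 2 * `|d| ^+ 2.
  by rewrite x1u normrN normrZ exprMn real_normK// num_real.
set q := `|_ - _| ^+ 2.
have := Gle u x1; have := Gge u x2.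
have -> : 1 / (2 * tau) * (q + `|e| ^+ 2 - 2 * mu * ip e d -
    2 * tau * theta * ip w e) = 1 / (2 * tau) * q + 1 / (2 * tau) * `|e| ^+ 2
    - mu / tau * ip e d - theta * ip w e by field; rewrite gt_eqF.
lra.
Qed.

(** Expanding the quadratic model about [x], its gradient gives the linear term and its curvature
    the constant [1 / (2 tau) + ell / 2]. Convexity at [x] trades the linearization at [u] for
    [phi], leaving [G x - G u]. *)
Lemma proximal_subgradient (phi Fn : H -> R) (G : H -> H) (D : set H)
    (ell tau theta : R) (x u v w : H) :
  (forall x y, phi x + ip (G x) (y - x) <= phi y) ->
  0 < tau ->
  (forall y, D y -> Fn x + (phi u + ip (G u) (x - u)
    + 1 / (2 * tau) * `|x - v - (tau * theta) *: w| ^+ 2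
    + ell / 2 * `|x - u| ^+ 2) <=
  Fn y + (phi u + ip (G u) (y - u)
    + 1 / (2 * tau) * `|y - v - (tau * theta) *: w| ^+ 2
    + ell / 2 * `|y - u| ^+ 2)) ->
  forall y, D y -> phi x + Fn x
    + ip (theta *: w - tau^-1 *: (x - v) - ell *: (x - u) + (G x - G u)) (y - x)
    - (1 / (2 * tau) + ell / 2) * `|y - x| ^+ 2 <= phi y + Fn y.
Proof.
move=> Gle tau0 argm y Dy; have := argm y Dy.
set d := y - x.
have yv : y - v - (tau * theta) *: w = d + (x - v - (tau * theta) *: w).
  by rewrite -addrA [RHS]addrA [d + _]addrA subrK addrA.
have yu : y - u = d + (x - u) by rewrite addrA subrK.
have := Gle x y; rewrite -/d yv yu; clearbody d => Gd.
have -> : `|d + (x - v - (tau * theta) *: w)| ^+ 2 = `|d| ^+ 2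
    + 2 * ip (x - v) d - 2 * tau * theta * ip w d
    + `|x - v - (tau * theta) *: w| ^+ 2.
  rewrite (normD_sqr hH) ipBr ipZr (ipC ip d w) (ipC ip d (x - v)); ring.
rewrite (normD_sqr hH d (x - u)) ipDr (ipC ip d (x - u)).
set q := `|_ - _| ^+ 2.
have -> : 1 / (2 * tau) * (`|d| ^+ 2 + 2 * ip (x - v) d
    - 2 * tau * theta * ip w d + q) = 1 / (2 * tau) * `|d| ^+ 2
    + tau^-1 * ip (x - v) d - theta * ip w d + 1 / (2 * tau) * q.
  by field; rewrite gt_eqF.
rewrite !(ipDl, ipNl, ipZl); move: Gd; lra.
Qed.

End Descent.

(** * A Lyapunov function for sequences of ratios *)

Section Lyapunov.
Context {R : realType}.

(* With extrapolation the ratios [f n / g n] need not decrease; the Lyapunov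
   function adds a multiple of the last squared displacement to them. *)
Lemma ratio_lyapunov (f g d : nat -> R) (A ell mubar kbar : R) :
  (forall n, 0 <= f n) -> (forall n, 0 < g n) -> (forall n, 0 <= d n) ->
  d 0%N = 0 -> 0 < A -> 0 <= ell ->
  (forall n, f n.+1 <= f n / g n * g n.+1 - A / 2 * d n.+1 ^+ 2
    + mubar * (d n.+1 * d n) + ell / 2 * kbar ^+ 2 * d n ^+ 2) ->
  (exists m M : R,
     [/\ 0 < m, 0 < M, forall n, m <= g n <= M,
         0 <= mubar < A * Num.sqrt (m * M) / (2 * M) &
         ell != 0 -> kbar ^+ 2 < m * A / (ell * M)
           - 2 * m * mubar / (ell * Num.sqrt (m * M))])
  \/ (mubar = 0 /\ kbar = 0) ->
  exists (F : nat -> R) (c : R),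
    [/\ 0 <= c, F 0%N = f 0%N / g 0%N,
        forall n, f n / g n <= F n, forall n, F n.+1 <= F n &
        forall n, d n.+1 ^+ 2 <= c * g n.+1 * (F n - F n.+1)].
Proof.
move=> f0 g0 d0 d00 A0 ell0 step.
move=> [[m [M [m0 M0 gmM /andP[mu0 mub] kb]]]|[mu0 kb0]]; last first.
  (* Without extrapolation the ratios themselves decrease. This case has no bounds on [g], whence
     the factor [g n.+1] in the estimate of [d]. *)
  exists (fun n => f n / g n), (2 / A).
  have key n : A / 2 * d n.+1 ^+ 2 <= g n.+1 * (f n / g n - f n.+1 / g n.+1).
    have := step n; rewrite mu0 kb0 mulrBr (mulrC (g _) (f n.+1 / _)).
    rewrite divfK ?gt_eqF// expr0n /=; lra.
  split=> // [|n|n]; first by rewrite divr_ge0// ltW.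
    have : 0 <= g n.+1 * (f n / g n - f n.+1 / g n.+1).
      by apply: le_trans (key n); rewrite mulr_ge0 ?divr_ge0 ?sqr_ge0// ltW.
    by rewrite pmulr_rge0// subr_ge0.
  have /(ler_wpM2l (ltW (divr_gt0 (ltr0n R 2) A0))) := key n.
  by rewrite !mulrA divfK ?gt_eqF// divff// mul1r.
set s := Num.sqrt _ in mub kb.
have s0 : 0 < s by rewrite sqrtr_gt0 mulr_gt0.
have ss : s ^+ 2 = m * M by rewrite sqr_sqrtr// ltW// mulr_gt0.
(* Young's inequality with weights [s / m] and [m / s] splits [mubar d n.+1 d n]. Dividing by
   [g n.+1], estimated by [M] in the decreasing term and by [m] in the other, gives the coefficients
   [a] and [b]. *)
pose a := (A - mubar * s / m) / (2 * M).
pose b := (ell * kbar ^+ 2 + mubar * m / s) / (2 * m).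
have As : 0 <= A - mubar * s / m.
  have : mubar * s / m < A / 2.
    have -> : A / 2 = A * s / (2 * M) * s / m.
      have -> : A * s / (2 * M) * s / m = A * s ^+ 2 / (2 * M * m).
        by field; rewrite !gt_eqF.
      by rewrite ss; field; rewrite !gt_eqF.
    by rewrite ltr_pM2r ?invr_gt0// ltr_pM2r.
  have : 0 <= mubar * s / m by rewrite divr_ge0 ?mulr_ge0// ltW.
  lra.
have b0 : 0 <= b.
  apply: divr_ge0; last by rewrite mulr_ge0// ltW.
  apply: addr_ge0; first exact: mulr_ge0 ell0 (sqr_ge0 _).
  exact: divr_ge0 (mulr_ge0 mu0 (ltW m0)) (ltW s0).
(* As [s^2 = m M], both shares of [mubar] equal [mubar / (2 s)]; then [b < a] is the bound on
   [kbar], or that on [mubar] if [ell = 0]. *)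
have ab : b < a.
  have mus : mubar * s / m / (2 * M) = mubar / (2 * s).
    have -> : mubar / (2 * s) = mubar * s / (2 * s ^+ 2).
      by field; rewrite !gt_eqF.
    by rewrite ss; field; rewrite !gt_eqF.
  have aE : a = A / (2 * M) - mubar / (2 * s) by rewrite -mus /a mulrBl.
  have bE : b = ell * kbar ^+ 2 / (2 * m) + mubar / (2 * s).
    by rewrite /b; field; rewrite !gt_eqF.
  have lk : ell * kbar ^+ 2 < m * A / M - 2 * m * mubar / s.
    have [->|l0] := eqVneq ell 0.
      rewrite mul0r subr_gt0.
      have -> : m * A / M = 2 * m * (A * s / (2 * M)) / s.
        by field; rewrite !gt_eqF.
      by rewrite ltr_pM2r ?invr_gt0// ltr_pM2l// mulr_gt0.
    have lp : 0 < ell by rewrite lt_def l0.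
    have /(_ l0) := kb; rewrite -(ltr_pM2l lp).
    have -> // : ell * (m * A / (ell * M) - 2 * m * mubar / (ell * s)) =
      m * A / M - 2 * m * mubar / s by field; rewrite !gt_eqF.
  have : ell * kbar ^+ 2 / (2 * m) < (m * A / M - 2 * m * mubar / s) / (2 * m).
    by rewrite ltr_pM2r// invr_gt0 mulr_gt0.
  have -> : (m * A / M - 2 * m * mubar / s) / (2 * m) =
    A / (2 * M) - mubar / (2 * s) - mubar / (2 * s) by field; rewrite !gt_eqF.
  rewrite aE bE; lra.
have key n : f n.+1 / g n.+1 <= f n / g n - a * d n.+1 ^+ 2 + b * d n ^+ 2.
  have [mg gM] : m <= g n.+1 /\ g n.+1 <= M by apply/andP.
  have amgm : mubar * (d n.+1 * d n) <=
      mubar * s / m / 2 * d n.+1 ^+ 2 + mubar * m / s / 2 * d n ^+ 2.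
    have : 0 <= mubar / (2 * m * s) * (s * d n.+1 - m * d n) ^+ 2.
      by rewrite mulr_ge0 ?sqr_ge0// divr_ge0// ?mulr_ge0// ltW.
    have -> : mubar / (2 * m * s) * (s * d n.+1 - m * d n) ^+ 2 =
      mubar * s / m / 2 * d n.+1 ^+ 2 + mubar * m / s / 2 * d n ^+ 2
       - mubar * (d n.+1 * d n) by field; rewrite !gt_eqF.
    by rewrite subr_ge0.
  have aM : a * M = (A - mubar * s / m) / 2.
    by rewrite /a; field; rewrite !gt_eqF.
  have bm : b * m = (ell * kbar ^+ 2 + mubar * m / s) / 2.
    by rewrite /b; field; rewrite !gt_eqF.
  have aD : a * g n.+1 * d n.+1 ^+ 2 <= a * M * d n.+1 ^+ 2.
    by rewrite ler_wpM2r ?sqr_ge0// ler_wpM2l// (le_trans b0)// ltW.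
  have bD : b * m * d n ^+ 2 <= b * g n.+1 * d n ^+ 2.
    by rewrite ler_wpM2r ?sqr_ge0// ler_wpM2l.
  rewrite ler_pdivrMr//; have := step n; rewrite aM in aD; rewrite bm in bD.
  lra.
have ab0 : 0 < a - b by rewrite subr_gt0.
have keyF n : (a - b) * d n.+1 ^+ 2 <=
    f n / g n + b * d n ^+ 2 - (f n.+1 / g n.+1 + b * d n.+1 ^+ 2).
  have := key n; lra.
(* The factor [1 / m] in [c] is offset by [g n.+1 >= m], so the estimate has the same form as
   without extrapolation. *)
exists (fun n => f n / g n + b * d n ^+ 2), (1 / (m * (a - b))); split.
- by rewrite divr_ge0// mulr_ge0// ltW.
- by rewrite d00 expr0n mulr0 addr0.
- by move=> n; rewrite lerDl mulr_ge0// sqr_ge0.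
- move=> n; rewrite -subr_ge0; apply: le_trans (keyF n).
  by rewrite mulr_ge0 ?sqr_ge0// ltW.
move=> n; have /andP[mg _] := gmM n.+1.
apply: (@le_trans _ _ (1 / (m * (a - b)) * m * ((a - b) * d n.+1 ^+ 2))).
  rewrite le_eqVlt; apply/orP; left; apply/eqP; field.
  by rewrite !gt_eqF// ltW.
apply: ler_pM (keyF n).
- by rewrite !mulr_ge0 ?invr_ge0 ?mulr_ge0// ltW.
- by rewrite mulr_ge0 ?sqr_ge0// ltW.
- by rewrite ler_wpM2l// divr_ge0// mulr_ge0// ltW.
Qed.

End Lyapunov.

(** * The e-PSG iterates: feasibility and real-valued form of a step *)

Section Convergence.
Context {R : realType} {H : normedModType R} (ip : {dot H for idfun}).
Context (hH : fin_dim_hilbert ip) (S C : set H) (fs : H -> R^o).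
Context (fn fl g : H -> \bar R) (ell beta : R).
Context (S_closed : closed S) (S_convex : convex_set S).
Context (A1 : numerator_assumption ip S fs fn ell).
Context (A2 : denominator_assumption ip S g beta).
Context (A3 : nonsmooth_assumption ip S (numer fs fn) fn g fl C).
Context (delta zeta mubar kbar : R) (tau kappa mu : nat -> R).
Context (gs u v x : nat -> H).
Context (alg : ePSG ip S fs fn g beta ell delta zeta mubar kbar
             tau kappa mu gs u v x).
Context (g_sdiff :
  strictly_differentiable_near ip g (S `&` edom (numer fs fn))).

Let f := numer fs fn.
Let D := S `&` edom f.
Let G := gradient ip fs.
Let theta n := fine (f (x n)) / fine (g (x n)).
(* dist 0 = 0, as in the convention x_(-1) = x_0. *)
Let dist n := `|x n - x n.-1|.

Lemma numer_fin_num z : D z ->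
  [/\ fn z \is a fin_num, f z \is a fin_num & fine (f z) = fs z + fine (fn z)].
Proof.
move=> [_]; rewrite /edom /f /numer /=; have := (fn_proper A1).1 z.
by case: (fn z) => //= r _ _; split.
Qed.

Lemma feasible_fin_num z : S z -> fn z \is a fin_num -> D z.
Proof.
move=> Sz fnz; split=> //=; rewrite /edom /f /numer /=.
by case: (fn z) fnz => // r _; rewrite -EFinD ltry.
Qed.

Lemma denominator_fin_num z : S z -> g z \is a fin_num.
Proof. by move=> /(g_finite_pos A2); case: (g z) => //; rewrite andbF. Qed.

Lemma denominator_gt0 z : S z -> 0 < fine (g z).
Proof. by move=> /(g_finite_pos A2)/fine_quot_gt0. Qed.

Lemma fs_gradient_le y z : fs y + ip (G y) (z - y) <= fs z.
Proof. exact: convex_gradient_le (fs_convex A1) (fs_differentiable A1 y). Qed.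

Lemma fs_gradient_dist y z : `|G y - G z| <= ell * `|y - z|.
Proof.
by have lip := fs_gradient_lipschitz A1; apply: (lip (y, z)).
Qed.

Lemma fs_descent y z :
  fs z <= fs y + ip (G y) (z - y) + ell / 2 * `|z - y| ^+ 2.
Proof. exact: (descent_lemma hH fs_gradient_le fs_gradient_dist). Qed.

Lemma nonsmooth_calm xbar : D xbar ->
  exists k r : R, 0 < r /\ forall y, D y -> `|y - xbar| < r ->
    `|fine (fn y) - fine (fn xbar)| <= k * `|y - xbar|.
Proof.
move=> Db.
(* Finiteness of [fn] on [D] forces the indicator of [C] to vanish. *)
have flE y : D y -> fn y = fl y.
  move=> /numer_fin_num[+ _ _]; rewrite (fn_decomposition A3) /indicator.
  case: ifP => _; first by rewrite adde0.
  by have := fl_gtNy A3 y; case: (fl y).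
suff [k [r [r0 rP]]] : exists k r : R, 0 < r /\ forall y, `|y - xbar| < r ->
    fl y \is a fin_num /\ `|fine (fl y) - fine (fl xbar)| <= k * `|y - xbar|.
  by exists k, r; split=> // y Dy yr; rewrite !flE//; have [] := rP y yr.
case: (fl_cases A3) => [[lip _ _]|[[U [_ DU lip]] _ _ _]|[[U [_ DU sd]] _]].
- exact: locally_lipschitz_calm lip I.
- exact: locally_lipschitz_calm lip (DU _ Db).
- have [w] := strict_gradientP (sd _ (DU _ Db)).
  exact: strict_gradient_calm.
Qed.

(** The model is finite at [x n], hence at its minimizer. *)
Lemma step_argmin_feasible n : D (x n) -> D (x n.+1).
Proof.
move=> Dn; have [_ _ _ _ [Sn argm]] := ePSG_step alg n.
apply: feasible_fin_num => //.
have [fnn _ _] := numer_fin_num Dn.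
have := argm _ Dn.1; have := (fn_proper A1).1 (x n.+1).
by case: (fn (x n.+1)) => //; case: (fn (x n)) fnn.
Qed.

Lemma iterate_feasible n : D (x n).
Proof.
elim: n => [|n]; first exact: init_feasible alg.
exact: step_argmin_feasible.
Qed.

Lemma theta_quotE n : fine (quot f g (x n)) = theta n.
Proof.
have [_ fx _] := numer_fin_num (iterate_feasible n).
rewrite quot_fineE//; apply: (g_finite_pos A2).
exact: (iterate_feasible n).1.
Qed.

Lemma step_argmin n y : D y ->
  fine (fn (x n.+1)) + (fs (u n) + ip (G (u n)) (x n.+1 - u n)
    + 1 / (2 * tau n) * `|x n.+1 - v n - (tau n * theta n) *: gs n| ^+ 2
    + ell / 2 * `|x n.+1 - u n| ^+ 2) <=
  fine (fn y) + (fs (u n) + ip (G (u n)) (y - u n)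
    + 1 / (2 * tau n) * `|y - v n - (tau n * theta n) *: gs n| ^+ 2
    + ell / 2 * `|y - u n| ^+ 2).
Proof.
move=> Dy; have [_ _ _ _ [_ /(_ y Dy.1)]] := ePSG_step alg n.
rewrite -/f theta_quotE.
have [+ _ _] := numer_fin_num Dy.
have [+ _ _] := numer_fin_num (iterate_feasible n.+1).
by move=> /fineK {1}<- /fineK {1}<-; rewrite -!EFinD lee_fin.
Qed.

(** * Sufficient decrease along the iterates *)

Lemma subgradient_strict n : strict_gradient ip g (x n) (gs n).
Proof.
have [U [_ DU sd]] := g_sdiff.
have [w gw] := strict_gradientP (sd _ (DU _ (iterate_feasible n))).
have [lsg _ _ _ _] := ePSG_step alg n.
by rewrite (limiting_subdiff_eq_strict_gradient hH gw lsg).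
Qed.

Lemma subgradient_le n : fine (g (x n)) + ip (gs n) (x n.+1 - x n)
  - beta / 2 * `|x n.+1 - x n| ^+ 2 <= fine (g (x n.+1)).
Proof.
have [Sn Sn1] := ((iterate_feasible n).1, (iterate_feasible n.+1).1).
have [U [SU wU]] : exists U, S `<=` U /\ weakly_convex_on g U beta.
  case: (g_weakly_convex A2) => [[U [_ _ SU wU]]|[_ wS]].
    by exists U.
  by exists S; split=> // z.
apply: (strict_gradient_weakly_convex_le (subgradient_strict n)).
  by case: wU.
move=> t t01; apply: (weakly_convex_segment hH wU SU) => //.
exact: denominator_fin_num.
Qed.

Lemma theta_ge0 n : 0 <= theta n.
Proof.
apply: divr_ge0; last exact/ltW/denominator_gt0/(iterate_feasible n).1.
by apply: fine_ge0; apply: (numer_ge0 A1); exact: iterate_feasible.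
Qed.

Lemma step_sizes n : [/\ 0 < tau n, delta <= (tau n)^-1 &
  Num.sqrt beta * theta n / zeta <= (tau n)^-1].
Proof.
have [_ /andP[t0 t1] _ _ _] := ePSG_step alg n; split=> //.
all: move: t1; rewrite -/f theta_quotE div1r -[in X in X -> _](invrK (tau n)).
all: rewrite lef_pV2 ?posrE ?invr_gt0// ?lt_max ?(delta_gt0 alg) ?orbT//.
all: by rewrite ge_max => /andP[].
Qed.

(** The weak convexity defect, [beta theta n / 2] times the squared displacement, is absorbed by the
    proximal term; the bound on [tau n] leaves [delta (1 - sqrt beta zeta) / 2]. *)
Lemma step_decrease n : fine (f (x n.+1)) <= theta n * fine (g (x n.+1))
  - delta * (1 - Num.sqrt beta * zeta) / 2 * dist n.+1 ^+ 2
  + mubar * (dist n.+1 * dist n) + ell / 2 * kbar ^+ 2 * dist n ^+ 2.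
Proof.
have [_ _ [uE /andP[k0 kk]] [vE /andP[m0 mm]] _] := ePSG_step alg n.
have [t0 dt zt] := step_sizes n.
have := proximal_step_decrease (Fn := fun y => fine (fn y)) hH fs_gradient_le
  fs_descent t0 uE vE (step_argmin n (iterate_feasible n)).
have [_ _ <-] := numer_fin_num (iterate_feasible n).
have [_ _ <-] := numer_fin_num (iterate_feasible n.+1).
have g0 := denominator_gt0 (iterate_feasible n).1.
have -> : fine (f (x n)) = theta n * fine (g (x n)) by rewrite divfK// gt_eqF.
have := subgradient_le n; rewrite -/(dist n.+1) -/(dist n) => gle.
have beta0 : 0 <= beta.
  by case: (g_weakly_convex A2) => [[U [_ _ _ []]]|[_ []]].
have := ler_wpM2l (theta_ge0 n) gle.
have z0 := zeta_gt0 alg; have zs := zeta_small alg.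
(* This is [sqrt beta theta n / zeta <= 1 / tau n] multiplied by [sqrt beta zeta]. *)
have bt : beta * theta n <= Num.sqrt beta * zeta * (tau n)^-1.
  rewrite -[X in X * _](sqr_sqrtr beta0) expr2 -!mulrA ler_wpM2l ?sqrtr_ge0//.
  by move: zt; rewrite ler_pdivrMr// mulrC [leRHS]mulrC.
have At : delta * (1 - Num.sqrt beta * zeta) <= (tau n)^-1 - beta * theta n.
  apply: (@le_trans _ _ ((tau n)^-1 * (1 - Num.sqrt beta * zeta))).
    by rewrite ler_wpM2r// ltW.
  rewrite mulrBr mulr1; lra.
have d1 : 0 <= dist n.+1 ^+ 2 by rewrite sqr_ge0.
have := ler_wpM2r d1 At.
have mt : mu n / tau n <= mubar by rewrite ler_pdivrMr.
have mip : mu n / tau n * ip (x n.+1 - x n) (x n - x n.-1) <=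
    mubar * (dist n.+1 * dist n).
  apply: (@le_trans _ _ (mu n / tau n * (dist n.+1 * dist n))).
    by rewrite ler_wpM2l ?divr_ge0 ?(ltW t0)//; exact: cauchy_schwarz hH _ _.
  exact: ler_wpM2r (mulr_ge0 (normr_ge0 _) (normr_ge0 _)) _ _ mt.
have kd : ell / 2 * kappa n ^+ 2 * dist n ^+ 2 <=
    ell / 2 * kbar ^+ 2 * dist n ^+ 2.
  rewrite ler_wpM2r ?sqr_ge0// ler_wpM2l ?divr_ge0 ?(ell_ge0 A1)//.
  by rewrite lerXn2r ?nnegrE// (le_trans k0).
have -> : 1 / (2 * tau n) = (tau n)^-1 / 2 by field; rewrite gt_eqF.
lra.
Qed.

Lemma iterate_lyapunov : exists (F : nat -> R) (c : R),
  [/\ 0 <= c, F 0%N = theta 0,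
      forall n, theta n <= F n, forall n, F n.+1 <= F n &
      forall n, dist n.+1 ^+ 2 <= c * fine (g (x n.+1)) * (F n - F n.+1)].
Proof.
apply: (ratio_lyapunov (f := fun n => fine (f (x n)))
  (g := fun n => fine (g (x n))) _ _ _ _ _ (ell_ge0 A1) step_decrease).
- by move=> n; apply: fine_ge0; apply: (numer_ge0 A1); exact: iterate_feasible.
- by move=> n; exact: denominator_gt0 (iterate_feasible n).1.
- by move=> n; exact: normr_ge0.
- by rewrite /dist subrr normr0.
- exact: mulr_gt0 (delta_gt0 alg) (zeta_small alg).
case: (extrapolation alg) => [[m [M [[m0 M0 gmM] mub k0 kb]]]|[_ -> ->]];
  [left|by right].
exists m, M; split=> //.
  move=> n; have := gmM _ (iterate_feasible n).
  by rewrite -(fineK (denominator_fin_num (iterate_feasible n).1)) !lee_fin.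
move=> /kb; rewrite (mulrA m delta); set X := _ - _ => kX.
(* As [kbar >= 0], the root is positive; the root of a nonpositive number being [0], [X] is positive
   and squaring recovers it. *)
have X0 : 0 < X by rewrite -sqrtr_gt0; exact: le_lt_trans kX.
by rewrite -[X]sqr_sqrtr ?(ltW X0)// ltrXn2r// nnegrE sqrtr_ge0.
Qed.

(** * Limits along subsequences *)

Lemma denominator_cvg (y : nat -> H) (xbar : H) : S xbar ->
  y k @[k --> \oo] --> xbar ->
  fine (g (y k)) @[k --> \oo] --> fine (g xbar).
Proof.
move=> Sb yx; have [U [_ SU cg]] := g_continuous A2.
apply: fine_cvg; rewrite fineK ?denominator_fin_num//.
exact: (cvg_comp y g yx (cg _ (SU _ Sb))).
Qed.

Lemma smooth_part_cvg (y : nat -> H) (xbar : H) :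
  y k @[k --> \oo] --> xbar -> fs (y k) @[k --> \oo] --> fs xbar.
Proof.
move=> yx; apply: (cvg_comp y fs yx).
exact: differentiable_continuous (fs_differentiable A1 xbar).
Qed.

(** The index is shifted because step [n] yields a subgradient at [x n.+1]. The choice [N k >= k]
    makes [N] tend to infinity. *)
Lemma cluster_subsequence (xbar : H) : cluster (x n @[n --> \oo]) xbar ->
  exists N : nat -> nat,
    N k @[k --> \oo] --> \oo /\ x (N k).+1 @[k --> \oo] --> xbar.
Proof.
move=> cx.
have sub (k : nat) : exists n, (k <= n)%N /\ `|x n.+1 - xbar| < k.+1%:R^-1.
  have [||z [[n /= kn <-] xn]] :=
    cx (x @` [set n | (k < n)%N]) [set z | `|z - xbar| < k.+1%:R^-1].
  - by exists k.+1 => // n kn; exists n.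
  - by apply/nbhs_distP; exists k.+1%:R^-1 => //; rewrite invr_gt0.
  - by case: n kn xn => // n kn xn; exists n.
exists (fun k => projT1 (cid (sub k))); split.
  move=> A [m _ mA]; exists m => // k /= mk; apply: mA => /=.
  by case: cid => n [kn _] /=; exact: leq_trans kn.
apply/cvgrPdistC_lt => e e0.
have [m _ me] : \forall k \near \oo, k.+1%:R^-1 < e :> R.
  exact: near_infty_natSinv_lt (PosNum e0).
exists m => // k /me; case: cid => n [_ xn] /=; exact: lt_trans.
Qed.

(** At [n = 0] both sides vanish, since [0.-1 = 0]. *)
Lemma dist_le0 (c : R) (F : nat -> R) :
  (forall n, dist n.+1 ^+ 2 <= c * fine (g (x n.+1)) * (F n - F n.+1)) ->
  forall n, dist n ^+ 2 <= c * fine (g (x n)) * (F n.-1 - F n).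
Proof. by move=> h [|n] //=; rewrite /dist !subrr normr0 expr0n mulr0. Qed.

(** [F] decreases and is nonnegative, so its increments tend to 0, while the factor [g (x (N k))]
    converges by continuity of [g] at [xbar]. *)
Lemma dist_cvg0 (N : nat -> nat) (xbar : H) : S xbar ->
  N k @[k --> \oo] --> \oo -> x (N k) @[k --> \oo] --> xbar ->
  dist (N k) @[k --> \oo] --> 0 /\ x (N k).-1 @[k --> \oo] --> xbar.
Proof.
move=> Sb Noo xN; have [F [c [c0 _ tF Fdec dF]]] := iterate_lyapunov.
have {}dF := dist_le0 dF.
have Fcv : cvgn F.
  apply: nonincreasing_is_cvgn; first exact/nonincreasing_seqP.
  by exists 0 => _ [n _ <-]; exact: le_trans (theta_ge0 n) (tF n).
have predoo : n.-1 @[n --> \oo] --> \oo.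
  by move=> A [m _ mA]; exists m.+1 => // [[|n]]//= mn; exact: mA.
have dF0 : F (N k).-1 - F (N k) @[k --> \oo] --> 0.
  rewrite -[X in _ --> X](subrr (limn F)); apply: cvgB.
  - exact: (cvg_comp _ F (cvg_comp N predn Noo predoo) Fcv).
  - exact: (cvg_comp N F Noo Fcv).
have sq0 : c * fine (g (x (N k))) * (F (N k).-1 - F (N k)) @[k --> \oo] --> 0.
  rewrite -[X in _ --> X](mulr0 (c * fine (g xbar))).
  by apply: cvgM => //; apply: cvgM; [exact: cvg_cst|exact: denominator_cvg].
have d0 : dist (N k) @[k --> \oo] --> 0.
  apply/cvgr0Pnorm_lt => e e0; have e20 : 0 < e ^+ 2 by rewrite exprn_gt0.
  move/cvgr0Pnorm_lt : sq0 => /(_ _ e20); apply: filterS => k sk.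
  rewrite ger0_norm ?normr_ge0// -(ltr_pXn2r (n := 2)) ?nnegrE ?normr_ge0
    ?(ltW e0)//.
  exact: le_lt_trans (dF (N k)) (le_lt_trans (ler_norm _) sk).
split=> //.
have -> : (fun k => x (N k).-1) = (fun k => x (N k) - (x (N k) - x (N k).-1)).
  by apply/funext => k; rewrite opprB addrC subrK.
rewrite -[X in _ --> X](subr0 xbar); apply: cvgB => //.
exact: norm_cvg0 d0.
Qed.

(** The Lyapunov function gives [theta n <= F 0], that is [fn (x (N k)) <= b k] with [b] convergent;
    lower semicontinuity of [fn] then excludes [fn xbar = +oo]. *)
Lemma cluster_feasible (N : nat -> nat) (xbar : H) :
  x (N k) @[k --> \oo] --> xbar -> D xbar.
Proof.
move=> xN.
have Sb : S xbar.
  apply: (closed_cvg S S_closed _ _ xN).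
  by apply: nearW => k; exact: (iterate_feasible _).1.
have [F [c [_ F0 tF Fdec _]]] := iterate_lyapunov.
have tF0 n : theta n <= F 0%N.
  apply: le_trans (tF n) _; elim: n => // n; exact: le_trans.
pose b k := F 0%N * fine (g (x (N k))) - fs (x (N k)).
have bcv : b k @[k --> \oo] --> F 0%N * fine (g xbar) - fs xbar.
  apply: cvgB; last exact: smooth_part_cvg.
  by apply: cvgM; [exact: cvg_cst|exact: denominator_cvg].
have fnb k : (fn (x (N k)) <= (b k)%:E)%E.
  have [fnx _ fE] := numer_fin_num (iterate_feasible (N k)).
  rewrite -(fineK fnx) lee_fin lerBrDl -fE.
  rewrite -ler_pdivrMr ?denominator_gt0//; last exact: (iterate_feasible _).1.
  exact: tF0.
apply: feasible_fin_num => //; rewrite fin_numE (fn_proper A1).1 /=.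
apply/eqP => fny.
have lsc := fn_lsc A1.
have [|V xV VP] := lsc xbar (F 0%N * fine (g xbar) - fs xbar + 1).
  by rewrite fny ltry.
have := xN _ xV; have : \forall k \near \oo,
    b k < F 0%N * fine (g xbar) - fs xbar + 1.
  by apply: (cvgr_lt _ bcv); rewrite ltrDl.
move=> bl Vx; have [k [bk Vk]] := filter_ex (filterI bl Vx).
have := le_lt_trans (le_trans (ltW (VP _ Vk)) (fnb k)) _.
move=> /(_ (F 0%N * fine (g xbar) - fs xbar + 1)%:E).
by rewrite lte_fin => /(_ bk); rewrite ltxx.
Qed.

(** Calmness of [fn] along [D] gives the convergence of values that the limiting subdifferential
    demands. *)
Lemma numer_cvg (y : nat -> H) (xbar : H) : D xbar -> (forall k, D (y k)) ->
  y k @[k --> \oo] --> xbar ->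
  fine (f (y k)) @[k --> \oo] --> fine (f xbar).
Proof.
move=> Db Dy yx; have [_ _ ->] := numer_fin_num Db.
have -> : (fun k => fine (f (y k))) = (fun k => fs (y k) + fine (fn (y k))).
  by apply/funext => k; have [] := numer_fin_num (Dy k).
apply: cvgD; first exact: smooth_part_cvg.
have [K [r [r0 rP]]] := nonsmooth_calm Db.
apply/subr_cvg0; apply: norm_cvg0.
apply: (@squeeze_cvgr _ _ _ _ (fun=> 0) (fun k => K * `|y k - xbar|)).
- move/cvgrPdistC_lt : yx => /(_ _ r0); apply: filterS => k kr.
  by rewrite normr_ge0 rP.
- exact: cvg_cst.
rewrite -[X in _ --> X](mulr0 K); apply: cvgM; first exact: cvg_cst.
rewrite -[X in _ --> X](normr0 H); apply: cvg_norm.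
by rewrite -[X in _ --> X](subrr xbar); apply: cvgB => //; exact: cvg_cst.
Qed.

Lemma subgradient_cvg (N : nat -> nat) (xbar w : H) :
  strict_gradient ip g xbar w -> x (N k) @[k --> \oo] --> xbar ->
  gs (N k) @[k --> \oo] --> w.
Proof.
move=> gw xN; apply/cvgrPdistC_le => e e0.
have [r r0 rP] := limiting_subdiff_strict_gradient hH gw e0.
move/cvgrPdistC_lt : xN => /(_ _ r0); apply: filterS => k kr.
by apply: rP kr _; have [] := ePSG_step alg (N k).
Qed.

Lemma inverse_step_size_bounded (taubar : R) :
  limn_einf (fun n => (tau n)%:E) = taubar%:E -> 0 < taubar ->
  exists2 T : R, 0 <= T & \forall n \near \oo, (tau n)^-1 <= T.
Proof.
(* Eventually [tau n] exceeds [taubar / 2]. *)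
move=> tl t0; exists (2 / taubar); first by rewrite divr_ge0// ltW.
have : ((taubar / 2)%:E < limf_einf (fun n => (tau n)%:E) \oo)%E.
  rewrite [ltRHS]tl lte_fin; lra.
rewrite limf_einfE => /ereal_sup_gt[_ [V Voo <-] tV].
apply: filterS Voo => n Vn; have [tn0 _ _] := step_sizes n.
have /(lt_le_trans tV) :
    (ereal_inf ((fun n => (tau n)%:E) @` V) <= (tau n)%:E)%E.
  by apply: ereal_inf_lbound; exists n.
rewrite lte_fin => /ltW tn; rewrite -[2 / _]invf_div lef_pV2// posrE//.
by rewrite divr_gt0.
Qed.

(** * Vanishing subgradients of the objective *)

Lemma objective_frechet_subdiff n :
  frechet_subdiff ip (fractional_objective f g S) (x n.+1)
    ((fine (g (x n.+1)))^-1 *: ((theta n *: gs n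
      - (tau n)^-1 *: (x n.+1 - v n) - ell *: (x n.+1 - u n)
      + (G (x n.+1) - G (u n))) - theta n.+1 *: gs n.+1)).
Proof.
have [t0 _ _] := step_sizes n; have Dn := iterate_feasible n.+1.
apply: (frechet_subdiff_quot (K := 1 / (2 * tau n) + ell / 2) hH) => //.
- by move=> z /numer_fin_num[].
- exact: g_finite_pos A2.
- exact: numer_ge0 A1 _ Dn.
- exact: subgradient_strict.
- apply: addr_ge0; first by rewrite divr_ge0// mulr_ge0// ltW.
  exact: divr_ge0 (ell_ge0 A1) _.
move=> z Dz; have [_ _ ->] := numer_fin_num Dn.
have [_ _ ->] := numer_fin_num Dz.
exact: (proximal_subgradient (Fn := fun y => fine (fn y)) (D := D) hH
  fs_gradient_le t0 (step_argmin n)).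
Qed.

(** This vector separates the proximal subgradient from [theta n *: gs n]. The constraint
    [mu n <= mubar tau n] controls the inertial term after division by [tau n]; [ell] counts twice,
    for the penalty and for the gradient of [fs]. *)
Lemma residual_le n (T : R) : 0 <= T -> (tau n)^-1 <= T ->
  `|- ((tau n)^-1 *: (x n.+1 - v n)) - ell *: (x n.+1 - u n)
    + (G (x n.+1) - G (u n))| <=
  (T + 2 * ell) * dist n.+1 + (mubar + 2 * ell * kbar) * dist n.
Proof.
move=> T0 tT; have [t0 _ _] := step_sizes n.
have [_ _ [uE /andP[k0 kk]] [vE /andP[m0 mm]] _] := ePSG_step alg n.
have ell0 := ell_ge0 A1.
have [d0 d1] : 0 <= dist n /\ 0 <= dist n.+1 by split; exact: normr_ge0.
have xu : `|x n.+1 - u n| <= dist n.+1 + kbar * dist n.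
  rewrite uE opprD addrA (le_trans (ler_normB _ _))// lerD2l normrZ.
  by rewrite ger0_norm// ler_wpM2r.
have xv : (tau n)^-1 * `|x n.+1 - v n| <= T * dist n.+1 + mubar * dist n.
  apply: (@le_trans _ _ ((tau n)^-1 * (dist n.+1 + mu n * dist n))).
    rewrite ler_wpM2l ?invr_ge0 ?(ltW t0)// vE opprD addrA.
    by rewrite (le_trans (ler_normB _ _))// normrZ (ger0_norm m0).
  rewrite mulrDr mulrA lerD ?ler_wpM2r//.
  by rewrite mulrC ler_pdivrMr.
have Gxu := fs_gradient_dist (x n.+1) (u n).
have exu := ler_wpM2l ell0 xu.
have h1 := ler_normD (- ((tau n)^-1 *: (x n.+1 - v n)) - ell *: (x n.+1 - u n))
  (G (x n.+1) - G (u n)).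
have h2 := ler_normB (- ((tau n)^-1 *: (x n.+1 - v n))) (ell *: (x n.+1 - u n)).
rewrite normrN !normrZ !ger0_norm ?invr_ge0 ?(ltW t0)// in h2.
lra.
Qed.

Lemma cluster_stationary (taubar : R) (xbar : H) :
  limn_einf (fun n => (tau n)%:E) = taubar%:E -> 0 < taubar ->
  cluster (x n @[n --> \oo]) xbar -> stationary ip f g S xbar.
Proof.
move=> tl t0 /cluster_subsequence[N [Noo xN1]].
have N1oo : (N k).+1 @[k --> \oo] --> \oo.
  apply: (cvg_comp N Nat.succ Noo) => A [m _ mA].
  by exists m => // n mn; apply: mA; exact: leqW.
have Db := cluster_feasible (N := fun k => (N k).+1) xN1.
(* The displacement at [(N k).+1] vanishes, so [x (N k)] tends to [xbar] too and the same argument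
   applies one index earlier. *)
have [d1 xN] := dist_cvg0 (N := fun k => (N k).+1) Db.1 N1oo xN1.
rewrite /= in xN; have [d0 _] := dist_cvg0 Db.1 Noo xN.
have [T T0 tT] := inverse_step_size_bounded tl t0.
have [U [_ DU sd]] := g_sdiff.
have [w gw] := strict_gradientP (sd _ (DU _ Db)).
have [_ fb _] := numer_fin_num Db; have gb := g_finite_pos A2 Db.1.
have gb0 := denominator_gt0 Db.1.
have thcv (M : nat -> nat) : x (M k) @[k --> \oo] --> xbar ->
    theta (M k) @[k --> \oo] --> fine (f xbar) / fine (g xbar).
  move=> xM; apply: cvgM.
    by apply: numer_cvg => // k; exact: iterate_feasible.
  by apply: cvgV; [rewrite gt_eqF|exact: denominator_cvg Db.1 xM].
split; first exact: Db.1.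
split; first by rewrite fractional_objectiveE.
exists (fun k => x (N k).+1), (fun k => (fine (g (x (N k).+1)))^-1 *:
  ((theta (N k) *: gs (N k) - (tau (N k))^-1 *: (x (N k).+1 - v (N k))
    - ell *: (x (N k).+1 - u (N k)) + (G (x (N k).+1) - G (u (N k))))
   - theta (N k).+1 *: gs (N k).+1)); split=> //.
- rewrite fractional_objectiveE//.
  have -> : (fun k => fractional_objective f g S (x (N k).+1)) =
      (fun k => (theta (N k).+1)%:E).
    apply/funext => k; have Dk := iterate_feasible (N k).+1.
    have [_ fk _] := numer_fin_num Dk.
    by rewrite fractional_objectiveE//; apply: (g_finite_pos A2); exact: Dk.1.
  by apply: cvg_EFin; [exact: nearW|exact: (thcv (fun k => (N k).+1))].
- by move=> k; exact: objective_frechet_subdiff.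
pose r k := - ((tau (N k))^-1 *: (x (N k).+1 - v (N k)))
  - ell *: (x (N k).+1 - u (N k)) + (G (x (N k).+1) - G (u (N k))).
have r0 : r k @[k --> \oo] --> 0.
  apply: norm_cvg0.
  apply: (@squeeze_cvgr _ _ _ _ (fun=> 0) (fun k =>
    (T + 2 * ell) * dist (N k).+1 + (mubar + 2 * ell * kbar) * dist (N k))).
  - have : \forall k \near \oo, (tau (N k))^-1 <= T by exact: Noo _ tT.
    apply: filterS => k tk; rewrite normr_ge0 /=.
    exact: residual_le.
  - exact: cvg_cst.
  rewrite -[X in _ --> X](addr0 0); apply: cvgD.
    rewrite -[X in _ --> X](mulr0 (T + 2 * ell)).
    by apply: cvgM => //; exact: cvg_cst.
  rewrite -[X in _ --> X](mulr0 (mubar + 2 * ell * kbar)).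
  by apply: cvgM => //; exact: cvg_cst.
(* The limit is put in the shape of the subgradients: their two [theta gs] terms have the same limit
   and cancel. *)
have -> : (0 : H) = (fine (g xbar))^-1 *:
    (((fine (f xbar) / fine (g xbar)) *: w + 0)
    - (fine (f xbar) / fine (g xbar)) *: w).
  by rewrite addr0 subrr scaler0.
apply: cvgZ.
  by apply: cvgV; [rewrite gt_eqF|exact: denominator_cvg Db.1 xN1].
apply: cvgB; last first.
  apply: cvgZ; first exact: (thcv (fun k => (N k).+1) xN1).
  exact: (subgradient_cvg (N := fun k => (N k).+1) gw xN1).
have -> : (fun k => theta (N k) *: gs (N k)
    - (tau (N k))^-1 *: (x (N k).+1 - v (N k))
    - ell *: (x (N k).+1 - u (N k)) + (G (x (N k).+1) - G (u (N k)))) =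
  (fun k => theta (N k) *: gs (N k) + r k).
  by apply/funext => k; rewrite /r !addrA.
apply: cvgD => //; apply: cvgZ; first exact: thcv xN.
exact: subgradient_cvg gw xN.
Qed.

End Convergence.

Unset Implicit Arguments.

Theorem corollary4p6 (R : realType) (H : normedModType R)
    (ip : {dot H for idfun}) (hH : fin_dim_hilbert ip)
    (S C : set H) (fs : H -> R^o) (fn fl g : H -> \bar R)
    (ell beta : R)
    (S_nonempty : S !=set0) (S_closed : closed S) (S_convex : convex_set S)
    (A1 : numerator_assumption ip S fs fn ell)
    (A2 : denominator_assumption ip S g beta)
    (A3 : nonsmooth_assumption ip S (numer fs fn) fn g fl C)
    (delta zeta mubar kbar : R) (tau kappa mu : nat -> R)
    (gs u v x : nat -> H)
    (alg : ePSG ip S fs fn g beta ell delta zeta mubar kbar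
             tau kappa mu gs u v x)
    (sublevel_bounded :
       bounded_set [set z | S z /\
         (quot (numer fs fn) g z <= quot (numer fs fn) g (x 0%N))%E])
    (taubar : R)
    (tau_liminf : limn_einf (fun n => (tau n)%:E) = taubar%:E)
    (taubar_gt0 : 0 < taubar)
    (g_sdiff : strictly_differentiable_near ip g (S `&` edom (numer fs fn))) :
  forall xbar : H, cluster (x n @[n --> \oo]) xbar ->
    stationary ip (numer fs fn) g S xbar.
Proof.
move=> xbar.
exact: (cluster_stationary hH S_closed S_convex A1 A2 A3 alg g_sdiff
  tau_liminf taubar_gt0).
Qed.
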